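(* Let $0<\alpha<1$, let $\mathbf{x}\in\mathbb{R}^N$ have exactly $K$ nonzero coordinates with $0<K<N$, let $s_{ij}$ ($1\le i\le N$, $1\le j\le M$) be i.i.d. $S(\alpha,1)$, $y_j=\sum_{i=1}^N x_is_{ij}$, and for each $i$ let $\hat x_{i,min}=y_t/s_{it}$ with $t=\arg\min_{1\le j\le M}|y_j/s_{ij}|$. Let $\epsilon>0$, $\theta=\left(\sum_{i}|x_i|^\alpha\right)^{1/\alpha}$, $\psi=(\epsilon/\theta)^{\alpha/(1-\alpha)}$ with $\psi\le 1/3$, and $\delta>0$. If $$M\ge \frac{\log\left((N-K)/\delta\right)}{\log(1+\psi)},$$ then the expected number of false positives, i.e. of indices $i$ with $x_i=0$ and $|\hat x_{i,min}|>\epsilon$, is at most $\delta$.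
   Context: A random variable $Z$ has the symmetric $\alpha$-stable distribution with unit scale, $S(\alpha,1)$, if its characteristic function is $E e^{\sqrt{-1}Zt}=e^{-|t|^\alpha}$. *)

(* Defs.v *)
From HB Require Import structures.
From mathcomp Require Import all_boot all_order all_algebra.
From mathcomp Require Import all_classical all_reals all_analysis.
Set Implicit Arguments. Unset Strict Implicit. Unset Printing Implicit Defensive.
Import Order.TTheory GRing.Theory Num.Theory.
Import numFieldNormedType.Exports.
Local Open Scope classical_set_scope.
Local Open Scope ring_scope.

Definition mutually_independent (d : measure_display) (T : measurableType d)
  (R : realType) (P : probability T R) (I : finType) (X : I -> T -> R) : Prop :=
  (forall i, measurable_fun setT (X i)) /\
  forall (J : {set I}) (B : I -> set R),
    (forall i, i \in J -> measurable (B i)) ->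
    P (\bigcap_(i in [set i | i \in J]) (X i @^-1` B i)) =
    (\prod_(i in J) P (X i @^-1` B i))%E.

(* Z ~ S(alpha,1): E[exp(sqrt(-1) Z t)] = exp(-|t|^alpha) for all real t,
   written via real and imaginary parts: E[cos(tZ)] = exp(-|t|^alpha),
   E[sin(tZ)] = 0. *)
Definition sym_stable_unit (d : measure_display) (T : measurableType d)
  (R : realType) (P : probability T R) (alpha : R) (Z : T -> R) : Prop :=
  measurable_fun setT Z /\
  forall t : R,
    (\int[P]_w (cos (t * Z w))%:E = (expR (- (`|t| `^ alpha)))%:E)%E /\
    (\int[P]_w (sin (t * Z w))%:E = 0)%E.

Definition argmin_seq (I : Type) (R : realType) (f : I -> R) (s : seq I)
  : option I :=
  foldr (fun j acc => match acc with
                      | None => Some j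
                      | Some k => if f j <= f k then Some j else Some k
                      end) None s.

Definition meas (T : Type) (R : realType) (N M : nat) (x : 'I_N -> R)
  (s : 'I_N -> 'I_M -> T -> R) (j : 'I_M) (w : T) : R :=
  \sum_(i < N) x i * s i j w.

Definition xhat_min (T : Type) (R : realType) (N M : nat) (x : 'I_N -> R)
  (s : 'I_N -> 'I_M -> T -> R) (i : 'I_N) (w : T) : R :=
  match argmin_seq (fun j => `|meas x s j w / s i j w|) (enum 'I_M) with
  | Some t => meas x s t w / s i t w
  | None => 0
  end.

Definition false_positives (T : Type) (R : realType) (N M : nat)
  (x : 'I_N -> R) (s : 'I_N -> 'I_M -> T -> R) (eps : R) (w : T) : nat :=
  #|[set i : 'I_N | (x i == 0) && (eps < `|xhat_min x s i w|)]%SET|.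

(* Main.v *)
(* Let [x i = 0], and write [Y] for [y_j] and [S] for [s_ij], which are
   independent. With [A = Y - eps S] and [B = Y + eps S], the event
   [eps |S| < |Y|] is [sg A * sg B = 1], so it suffices to bound
   [E (sg A * sg B)]. From [a / (a^2 + l^2) = int_0^oo e^(-l u) sin (u a) du]
   and Fubini,
     [(pi / 2) E (g sg B) = int_0^oo E (g sin (u B)) du / u],
   and two applications of this identity give
     [(pi / 2)^2 E (sg A sg B)
        = int_0^oo int_0^oo E (sin (u A) sin (u m B)) dm / m du / u],
   whose integrand is explicit from the characteristic functions. With
   [p = theta^alpha] and [q = eps^alpha], integrating in [u] first (Frullani)
   leaves a multiple of
     [ln ((p b + q a) / (p a + q b)), a = |1 - m|^alpha, b = (1 + m)^alpha],
   which is at most [(p - q) / (p + q) ln (b / a)]. The right-hand side is the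
   same expression for [p = 1], [q = 0], that is for [A = B = S], where the
   double integral is at most [(pi / 2)^2]; hence no constant has to be computed.
   This gives [P (eps |S| < |Y|) <= p / (p + q) = 1 / (1 + (eps / theta)^alpha)],
   and [psi <= (eps / theta)^alpha] since [psi <= 1]. The columns are independent
   and the estimate exceeds [eps] only if all [M] ratios do. *)

Require Import Defs.
From HB Require Import structures.
From mathcomp Require Import all_boot all_order all_algebra.
From mathcomp Require Import all_classical all_reals all_analysis.
From mathcomp Require Import measurable_realfun ring lra.
Import Order.TTheory GRing.Theory Num.Theory.
Import numFieldNormedType.Exports.
Local Open Scope classical_set_scope.
Local Open Scope ring_scope.
Set Implicit Arguments.
Unset Strict Implicit.
Unset Printing Implicit Defensive.

(** * Integrals over the half-line *)

(** Only the open half-line matters, so [f] may blow up at 0, as u^(alpha - 1) does for alpha < 1.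
    The rays [D i] starting at 1/(i + 1) exhaust the half-line; the fundamental theorem applies on
    each of them and monotone convergence gives the limit. *)
Lemma ge0_FTC2_itv0y (R : realType) (f F : R -> R) (l0 l : R) :
  (forall x, 0 < x -> 0 <= f x) ->
  (forall x : R, 0 < x -> {for x, continuous f}) ->
  F x @[x --> +oo] --> l -> F x @[x --> 0^'+] --> l0 ->
  (forall x : R, 0 < x -> is_derive x 1 F (f x)) ->
  (\int[@lebesgue_measure R]_(x in `]0%R, +oo[) (f x)%:E = (l - l0)%:E)%E.
Proof.
move=> f0 cf Fl Fl0 dF.
have mf : measurable_fun `](0 : R), +oo[ f.
  apply: open_continuous_measurable_fun; first exact: interval_open.
  by move=> x; rewrite inE/= in_itv/= andbT; exact: cf.
pose D (i : nat) : set R := `[i.+1%:R^-1, +oo[%classic.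
have DE : \bigcup_i D i = `]0, +oo[%classic.
  apply/seteqP; split => x /=.
    move=> [i _]; rewrite /D /= !in_itv/= !andbT; apply: lt_le_trans.
    by rewrite invr_gt0.
  rewrite in_itv/= andbT => x0; exists (Num.truncn x^-1) => //.
  rewrite /D /= in_itv/= andbT -[leRHS]invrK lef_pV2 ?posrE ?invr_gt0//.
  by apply: ltW; rewrite truncnS_gt.
have sD i : D i `<=` `]0, +oo[%classic by rewrite -DE; exact: bigcup_sup.
have H : (\int[@lebesgue_measure R]_(x in D i) (f x)%:E)%E @[i --> \oo] -->
    (\int[@lebesgue_measure R]_(x in \bigcup_i D i) (f x)%:E)%E.
  apply: ge0_nondecreasing_set_cvg_integral => //.
  - move=> i j ij; apply/subsetPset => x; rewrite /D /= !in_itv/= !andbT.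
    by apply: le_trans; rewrite lef_pV2 ?posrE// ler_nat ltnS.
  - by move=> i; exact: measurable_itv.
  - by move=> i; apply/measurable_EFinP; exact: measurable_funS mf.
  - by move=> i x /sD /=; rewrite in_itv/= andbT lee_fin; exact: f0.
have E n : (\int[@lebesgue_measure R]_(x in D n) (f x)%:E =
    (l - F (n.+1%:R^-1))%:E)%E.
  have n0 : 0 < n.+1%:R^-1 :> R by rewrite invr_gt0.
  rewrite (ge0_continuous_FTC2y _ _ Fl)//.
  - by move=> x nx; apply/f0/(lt_le_trans n0).
  - apply/continuous_in_subspaceT => x; rewrite inE/= in_itv/= andbT => nx.
    exact/cf/(lt_le_trans n0).
  - by move=> x nx; have [] := dF _ (lt_trans n0 nx).
  - apply: cvg_at_right_filter; apply: differentiable_continuous.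
    by apply/derivable1_diffP; have [] := dF _ n0.
  - move=> x; rewrite in_itv/= andbT => nx; rewrite derive1E.
    by have [] := dF _ (lt_trans n0 nx).
rewrite -DE; apply: (cvg_unique _ H) => //.
rewrite (funext E); apply: cvg_EFin; first by near=> n.
apply: cvgB; first exact: cvg_cst.
have [/(_ Fl0 (fun n => n.+1%:R^-1))] := cvg_at_rightP F 0 l0.
move=> + _; apply => //.
by split; [move=> n; rewrite invr_gt0|exact: cvg_harmonic].
Unshelve. all: by end_near. Qed.

Lemma derivable_cvg_at_right {R : realType} (F : R -> R) (a : R) :
  derivable F a 1 -> F x @[x --> a^'+] --> F a.
Proof.
move=> dF; apply: cvg_at_right_filter; apply: differentiable_continuous.
exact/derivable1_diffP.
Qed.

Lemma derivable_continuous_pt {R : realType} (F : R -> R) (a : R) :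
  derivable F a 1 -> {for a, continuous F}.
Proof. by move=> dF; apply/differentiable_continuous/derivable1_diffP. Qed.

Lemma cvgy_expRNM {R : realType} (l : R) : 0 < l ->
  expR (- (l * x)) @[x --> +oo] --> (0 : R).
Proof.
move=> l0; apply: (@cvg_comp _ _ _ (fun x => l * x) (fun y => expR (- y))).
  exact: gt0_cvgMry.
exact: cvgr_expR.
Qed.

Lemma integral_expRNM {R : realType} (l : R) : 0 < l ->
  (\int[@lebesgue_measure R]_(u in `]0%R, +oo[) (expR (- (l * u)))%:E =
   (l^-1)%:E)%E.
Proof.
move=> l0; pose F u := - l^-1 * expR (- (l * u)).
apply: etrans; first apply: (@ge0_FTC2_itv0y _ _ F (F 0) 0).
- by move=> x x0; rewrite expR_ge0.
- by move=> x x0; exact: derivable_continuous_pt.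
- rewrite /F -[0 in X in _ --> X](mulr0 (- l^-1)); apply: cvgMr.
  exact: cvgy_expRNM.
- exact: derivable_cvg_at_right.
- move=> x x0; apply: is_derive_eq; rewrite /GRing.scale/=.
  by field; rewrite gt_eqF.
- by rewrite /F mulr0 oppr0 expR0 mulr1 sub0r opprK.
Qed.

Lemma measurable_sin {R : realType} : measurable_fun [set: R] (@sin R).
Proof. by apply: continuous_measurable_fun; exact: continuous_sin. Qed.

Lemma measurable_cos {R : realType} : measurable_fun [set: R] (@cos R).
Proof. by apply: continuous_measurable_fun; exact: continuous_cos. Qed.

Lemma integrable_expRNM {R : realType} (l : R) : 0 < l ->
  (@lebesgue_measure R).-integrable `]0, +oo[ (fun u => (expR (- (l * u)))%:E).
Proof.
move=> l0; apply/integrableP; split.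
  apply/measurable_EFinP/measurable_funTS.
  by apply: measurableT_comp => //; apply: measurable_funN; exact: measurable_funM.
under eq_integral do rewrite gee0_abs ?lee_fin ?expR_ge0//.
by rewrite integral_expRNM// ltry.
Qed.

Lemma integrable_expRNM_sin {R : realType} (l a : R) : 0 < l ->
  (@lebesgue_measure R).-integrable `]0, +oo[
    (fun u => (expR (- (l * u)) * sin (u * a))%:E).
Proof.
move=> l0; apply: (le_integrable _ _ _ (integrable_expRNM l0)) => //.
- apply/measurable_EFinP/measurable_funTS/measurable_funM => //.
    by apply: measurableT_comp => //; apply: measurable_funN; exact: measurable_funM.
  by apply: (measurableT_comp measurable_sin); exact: measurable_funM.
- move=> u _ /=; rewrite lee_fin normrM ger_pMr ?normr_gt0 ?gt_eqF ?expR_gt0//.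
  by rewrite ler_norml sin_geN1 sin_le1.
Qed.

(** The integrand changes sign, so the fundamental theorem for nonnegative functions is applied to
    exp(-l u) (1 + sin(u a)) instead, and the integral of exp(-l u) is then subtracted. *)
Lemma integral_expRNM_sin {R : realType} (l a : R) : 0 < l ->
  (\int[@lebesgue_measure R]_(u in `]0%R, +oo[)
     (expR (- (l * u)) * sin (u * a))%:E = (a / (a ^+ 2 + l ^+ 2))%:E)%E.
Proof.
move=> l0.
have al0 : l ^+ 2 + a ^+ 2 != 0.
  by rewrite gt_eqF// ltr_pwDl ?sqr_ge0// exprn_gt0.
pose F u := - expR (- (l * u)) / l
  - expR (- (l * u)) * (l * sin (u * a) + a * cos (u * a)) / (l ^+ 2 + a ^+ 2).
have H : (\int[@lebesgue_measure R]_(u in `]0%R, +oo[)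
    (expR (- (l * u)) + expR (- (l * u)) * sin (u * a))%:E = (0 - F 0)%:E)%E.
  apply: (@ge0_FTC2_itv0y _ _ F (F 0) 0).
  - by move=> x x0; rewrite -[X in X + _]mulr1 -mulrDr mulr_ge0 ?expR_ge0//.
  - by move=> x x0; exact: derivable_continuous_pt.
  (* This constant multiple of exp(-l x) dominates |F x|, from |sin| <= 1 and |cos| <= 1. *)
  - have F0 : (l^-1 + (l + `|a|) / (l ^+ 2 + a ^+ 2)) * expR (- (l * x)) @[x --> +oo] --> 0.
      rewrite -[0 in X in _ --> X](mulr0 (l^-1 + (l + `|a|) / (l ^+ 2 + a ^+ 2))).
      by apply: cvgMr; exact: cvgy_expRNM.
    apply/norm_cvg0P; apply: squeeze_cvgr F0; last exact: cvg_cst.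
    near=> x; rewrite normr_ge0/= /F.
    rewrite (le_trans (ler_normB _ _))// mulrDl lerD//.
      by rewrite normrM normrN (ger0_norm (expR_ge0 _)) gtr0_norm ?invr_gt0// mulrC.
    rewrite -mulrA normrM (ger0_norm (expR_ge0 _)) mulrC ler_wpM2r ?expR_ge0//.
    rewrite normrM (ger0_norm (_ : 0 <= (l ^+ 2 + a ^+ 2)^-1)); last first.
      by rewrite invr_ge0 addr_ge0 ?sqr_ge0.
    rewrite ler_wpM2r ?invr_ge0 ?addr_ge0 ?sqr_ge0//.
    rewrite (le_trans (ler_normD _ _))// !normrM lerD//.
      by rewrite gtr0_norm// ger_pMr// ler_norml sin_geN1 sin_le1.
    by rewrite ler_piMr// ler_norml cos_geN1 cos_le1.
  - exact: derivable_cvg_at_right.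
  - move=> x x0; apply: is_derive_eq; rewrite /GRing.scale/=.
    by field; rewrite al0 gt_eqF.
move: H; under eq_integral do rewrite EFinD.
rewrite integralD//; [|exact: integrable_expRNM|exact: integrable_expRNM_sin].
rewrite integral_expRNM// => /(congr1 (fun z => - (l^-1)%:E + z)%E).
rewrite addeA -EFinN -EFinD addNr add0e => ->.
rewrite -EFinD /F mulr0 mul0r oppr0 expR0 sin0 cos0; congr (_%:E).
by field; rewrite -[X in X != 0]addrC al0 gt_eqF.
Unshelve. all: by end_near. Qed.

Lemma integral_cauchy {R : realType} (a : R) : 0 < a ->
  (\int[@lebesgue_measure R]_(l in `]0%R, +oo[)
     (a / (a ^+ 2 + l ^+ 2))%:E = (pi / 2)%:E)%E.
Proof.
move=> a0; pose F l := atan (a^-1 * l).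
have d0 (x : R) : a ^+ 2 + x ^+ 2 != 0.
  by rewrite gt_eqF// ltr_pwDl ?sqr_ge0// exprn_gt0.
apply: etrans; first apply: (@ge0_FTC2_itv0y _ _ F (F 0) (pi / 2)).
- by move=> x x0; apply: divr_ge0; [exact: ltW|apply: addr_ge0; exact: sqr_ge0].
- move=> x x0; apply: continuousM; first exact: cvg_cst.
  apply: continuousV => //; apply: derivable_continuous_pt; exact: ex_derive.
- apply: (@cvg_comp _ _ _ (fun x => a^-1 * x) atan); last exact: cvgy_atan.
  apply: gt0_cvgMry => //. by rewrite invr_gt0.
- exact: derivable_cvg_at_right.
- move=> x x0; apply: is_derive_eq; rewrite /GRing.scale/=.
  by field; rewrite d0 gt_eqF.
- by rewrite /F mulr0 atan0 subr0.
Qed.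

Lemma cvgy_powR {R : realType} (alpha : R) : 0 < alpha ->
  x `^ alpha @[x --> +oo] --> +oo.
Proof.
move=> a0; apply/cvgryPge => A; near=> x.
rewrite (le_trans (ler_norm A))//.
rewrite -[leLHS]powRr1// -(mulVf (lt0r_neq0 a0)) powRrM.
by apply: ge0_ler_powR; rewrite ?nnegrE ?powR_ge0 1?ltW.
Unshelve. all: by end_near. Qed.

Lemma integral_powR_expR {R : realType} (alpha c : R) : 0 < alpha -> 0 < c ->
  (\int[@lebesgue_measure R]_(u in `]0%R, +oo[)
     (u `^ (alpha - 1) * expR (- (c * u `^ alpha)))%:E = ((alpha * c)^-1)%:E)%E.
Proof.
move=> a0 c0; pose F u := - (alpha * c)^-1 * expR (- (c * u `^ alpha)).
apply: etrans; first apply: (@ge0_FTC2_itv0y _ _ F (- (alpha * c)^-1) 0).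
- by move=> x x0; rewrite mulr_ge0 ?powR_ge0 ?expR_ge0.
- move=> x x0; apply: derivable_continuous_pt.
  have dp := is_derive1_powR alpha x0; have dp1 := is_derive1_powR (alpha - 1) x0.
  exact: ex_derive.
- rewrite /F -[0 in X in _ --> X](mulr0 (- (alpha * c)^-1)); apply: cvgMr.
  apply: (@cvg_comp _ _ _ (fun x => x `^ alpha) (fun y => expR (- (c * y)))).
    exact: cvgy_powR.
  exact: cvgy_expRNM.
(* A genuine one-sided limit is taken at 0: for alpha < 1 the power u^alpha has no derivative
   there. *)
- rewrite /F -[X in _ --> X]mulr1; apply: cvgMr.
  rewrite [X in _ --> X](_ : _ = expR (- (c * 0))); last first.
    by rewrite mulr0 oppr0 expR0.
  apply: (@cvg_comp _ _ _ (fun x => - (c * x `^ alpha)) expR _ (nbhs (- (c * 0)))).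
    by apply: cvgN; apply: cvgMr; exact: powR_cvg0.
  exact: continuous_expR.
- move=> x x0; have dp := is_derive1_powR alpha x0.
  apply: is_derive_eq; rewrite /GRing.scale/=.
  by field; rewrite !gt_eqF.
- by rewrite sub0r opprK.
Qed.

(** * Fubini on rectangles and the radial integral *)

Section fubini_in.
Context (d1 d2 : measure_display) (T1 : measurableType d1)
  (T2 : measurableType d2) (R : realType).
Variables (m1 : {sigma_finite_measure set T1 -> \bar R})
  (m2 : {sigma_finite_measure set T2 -> \bar R}).
Variables (D : set T1) (E : set T2) (mD : measurable D) (mE : measurable E).
Implicit Types f : T1 * T2 -> \bar R.

(** Extension by 0 outside the rectangle commutes with the inner integral. With its mirror image
    below, this reduces the statements over [D] and [E] to Fubini on the whole product. *)
Let restrict_setX1 f x : (\int[m2]_y (f \_ (D `*` E)) (x, y) =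
  ((fun x => \int[m2]_(y in E) f (x, y)) \_ D) x)%E.
Proof.
rewrite patchE; case: ifPn => [|]; rewrite ?inE => Dx.
  rewrite [RHS]integral_mkcond; apply: eq_integral => y _.
  by rewrite !patchE in_setX/= (_ : x \in D)// inE.
by rewrite integral0_eq// => y _; rewrite patchE in_setX/= (negbTE Dx).
Qed.

Let restrict_setX2 f y : (\int[m1]_x (f \_ (D `*` E)) (x, y) =
  ((fun y => \int[m1]_(x in D) f (x, y)) \_ E) y)%E.
Proof.
rewrite patchE; case: ifPn => [|]; rewrite ?inE => Ey.
  rewrite [RHS]integral_mkcond; apply: eq_integral => x _.
  by rewrite !patchE in_setX/= (_ : y \in E) ?andbT// inE.
by rewrite integral0_eq// => x _; rewrite patchE in_setX/= (negbTE Ey) andbF.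
Qed.

Lemma fubini_tonelli_in f : measurable_fun (D `*` E) f ->
  (forall x y, D x -> E y -> 0 <= f (x, y))%E ->
  (\int[m1]_(x in D) \int[m2]_(y in E) f (x, y) =
   \int[m2]_(y in E) \int[m1]_(x in D) f (x, y))%E.
Proof.
move=> mf f0; rewrite integral_mkcond [RHS]integral_mkcond.
rewrite -(funext (restrict_setX1 f)) -(funext (restrict_setX2 f)).
rewrite fubini_tonelli//.
  by apply/(measurable_restrictT _ _).1 => //; exact: measurableX.
by move=> z; apply: erestrict_ge0 => -[x y] []/=; exact: f0.
Qed.

Lemma Fubini_in f : measurable_fun (D `*` E) f ->
  (\int[m1]_(x in D) \int[m2]_(y in E) `|f (x, y)| < +oo)%E ->
  (\int[m1]_(x in D) \int[m2]_(y in E) f (x, y) =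
   \int[m2]_(y in E) \int[m1]_(x in D) f (x, y))%E.
Proof.
move=> mf foo; rewrite integral_mkcond [RHS]integral_mkcond.
rewrite -(funext (restrict_setX1 f)) -(funext (restrict_setX2 f)).
have mfDE : measurable_fun setT (f \_ (D `*` E)).
  by apply/(measurable_restrictT _ _).1 => //; exact: measurableX.
apply: Fubini; apply/integrable12ltyP => //.
under eq_integral => x _.
  under eq_integral => y _.
    rewrite (_ : `|_|%E = ((fun z => `|f z|) \_ (D `*` E))%E (x, y)); last first.
      by rewrite !patchE; case: ifPn; rewrite ?abse0.
    over.
  rewrite restrict_setX1; over.
by rewrite -integral_mkcond.
Qed.

Lemma measurable_fun_fubini_in f : measurable_fun (D `*` E) f ->
  (forall x y, D x -> E y -> 0 <= f (x, y))%E ->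
  measurable_fun D (fun x => \int[m2]_(y in E) f (x, y))%E.
Proof.
move=> mf f0; apply/(measurable_restrictT _ _).2 => //.
rewrite -(funext (restrict_setX1 f)).
apply: measurable_fun_fubini_tonelli_F.
  by apply/(measurable_restrictT _ _).1 => //; exact: measurableX.
by move=> z; apply: erestrict_ge0 => -[x y] []/=; exact: f0.
Qed.

(** A uniform bound on the inner integrals of |f| and a finite outer measure give absolute
    integrability. The outer measure will be the probability [P]. *)
Lemma Fubini_in_bounded f (C : R) : measurable_fun (D `*` E) f ->
  (m1 D < +oo)%E ->
  (forall x, D x -> \int[m2]_(y in E) `|f (x, y)| <= C%:E)%E ->
  (\int[m1]_(x in D) \int[m2]_(y in E) f (x, y) =
   \int[m2]_(y in E) \int[m1]_(x in D) f (x, y))%E.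
Proof.
move=> mf m1D fC; apply: Fubini_in => //.
(* The absolute value makes the constant nonnegative without a sign condition on [C]. *)
apply: (@le_lt_trans _ _ (\int[m1]_(x in D) `|C|%:E)%E).
  apply: ge0_le_integral => //.
  - by move=> x _; exact: integral_ge0.
  - apply: (@measurable_fun_fubini_in (fun z => `|f z|)%E) => //.
    exact: measurableT_comp.
  - by move=> x /fC /le_trans; apply; rewrite lee_fin ler_norm.
rewrite integral_cst// lte_mul_pinfty// lee_fin.
Qed.
End fubini_in.

Lemma is_derive_FTC2 {R : realType} (f F : R -> R) (p q : R) : p <= q ->
  (forall x : R, p <= x <= q -> {for x, continuous f}) ->
  (forall x : R, p <= x <= q -> is_derive x 1 F (f x)) ->
  (\int[@lebesgue_measure R]_(x in `[p, q]) (f x)%:E = (F q - F p)%:E)%E.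
Proof.
rewrite le_eqVlt => /predU1P[->|pq] cf dF.
  by rewrite set_itv1 integral_set1 subrr.
have cF x : p <= x <= q -> {for x, continuous F}.
  by move=> /dF[dFx _]; exact: derivable_continuous_pt.
rewrite (@continuous_FTC2 _ f F)// ?EFinB//.
- by apply: continuous_in_subspaceT => x; rewrite inE/= in_itv/=; exact: cf.
- split.
  + move=> x; rewrite in_itv/= => /andP[px xq].
    by have [] := dF x; rewrite ?ltW.
  + by apply: cvg_at_right_filter; apply: cF; rewrite lexx ltW.
  + by apply: cvg_at_left_filter; apply: cF; rewrite lexx ltW.
- move=> x; rewrite in_itv/= => /andP[px xq]; rewrite derive1E.
  by have [] := dF x; rewrite ?ltW.
Qed.

(** The integrand is the integral of u^(alpha - 1) exp(-c u^alpha) over c in [p, q]. After Tonelli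
    the integral in u is 1/(alpha c), and integrating this in c yields the logarithms. *)
Lemma frullani_powR {R : realType} (alpha p q : R) :
    0 < alpha -> 0 < p -> p <= q ->
  (\int[@lebesgue_measure R]_(u in `]0%R, +oo[)
     (u^-1 * (expR (- (p * u `^ alpha)) - expR (- (q * u `^ alpha))))%:E =
   (alpha^-1 * (ln q - ln p))%:E)%E.
Proof.
move=> a0 p0 pq.
pose f (z : measurableTypeR R * measurableTypeR R) : R :=
  z.1 `^ (alpha - 1) * expR (- (z.2 * z.1 `^ alpha)).
have mf : measurable_fun setT f.
  apply: measurable_funM.
    exact: (measurableT_comp (@measurable_powR R (alpha - 1))).
  apply: measurableT_comp => //; apply: measurable_funN; apply: measurable_funM => //.
  exact: (measurableT_comp (@measurable_powR R alpha)).
transitivity (\int[@lebesgue_measure R]_(u in `]0%R, +oo[)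
    \int[@lebesgue_measure R]_(c in `[p, q]) (f (u, c))%:E)%E.
  apply: eq_integral => u; rewrite inE/= in_itv/= andbT => u0.
  have ua0 := powR_gt0 alpha u0.
  pose F c := - u^-1 * expR (- (c * u `^ alpha)).
  apply/esym; apply: etrans; first apply: (@is_derive_FTC2 _ _ F) => //.
  - by move=> x _; rewrite /f/=; exact: derivable_continuous_pt.
  - move=> x _; apply: is_derive_eq; rewrite /GRing.scale/= /f/=.
    have -> : u `^ (alpha - 1) = u `^ alpha / u.
      by rewrite powRB ?powRr1 1?ltW// (gt_eqF u0) implybT.
    by ring.
  - by rewrite /F !mulNr opprK addrC mulrBr.
apply: etrans.
  apply: (fubini_tonelli_in _ _ _ _ (f := EFin \o f)) => //.
    exact/measurable_EFinP/measurable_funTS.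
  by move=> x y _ _; rewrite lee_fin mulr_ge0 ?powR_ge0 ?expR_ge0.
rewrite /f/=; under eq_integral => c.
  rewrite inE/= in_itv/= => /andP[pc _].
  rewrite integral_powR_expR//; last exact: lt_le_trans pc.
  over.
apply: etrans; first apply: (@is_derive_FTC2 _ _ (fun c => alpha^-1 * ln c)) => //.
- move=> x /andP[px _]; have x0 := lt_le_trans p0 px.
  by apply: continuousV; [rewrite mulf_neq0 ?gt_eqF|exact: derivable_continuous_pt].
- move=> x /andP[px _]; have x0 := lt_le_trans p0 px.
  have dl := is_derive1_ln x0.
  by apply: is_derive_eq; rewrite /GRing.scale/= invfM.
- by rewrite mulrBr.
Qed.

(** The right side minus the left, as a function [g] of b, vanishes at b = a. Its derivative is (p -
    q) p q (x - a)^2 over a positive denominator, so [g] is nondecreasing from a on. *)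
Lemma ln_ratio_le {R : realType} (p q a b : R) :
    0 < p -> 0 <= q <= p -> 0 < a -> a <= b ->
  ln (p * b + q * a) - ln (p * a + q * b) <=
  (p - q) / (p + q) * (ln b - ln a).
Proof.
move=> p0 /andP[q0 qp] a0 ab.
pose g x := (p - q) / (p + q) * (ln x - ln a) - ln (p * x + q * a) + ln (p * a + q * x).
suff : g a <= g b by rewrite /g; lra.
have pos x : a <= x -> [/\ 0 < x, 0 < p * x + q * a & 0 < p * a + q * x].
  move=> ax; have x0 := lt_le_trans a0 ax.
  by split => //; rewrite ltr_pwDl ?mulr_gt0// mulr_ge0// ltW.
have dg (x : R) : a <= x -> is_derive x 1 g ((p - q) / (p + q) * x^-1
    - p / (p * x + q * a) + q / (p * a + q * x)).
  move=> /pos[x0 y0 z0].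
  have dl := is_derive1_ln x0.
  have dl1 := is_derive1_ln y0.
  have dl2 := is_derive1_ln z0.
  have d1 : is_derive x 1 (fun x => ln (p * x + q * a)) (p / (p * x + q * a)).
    by apply: is_derive_eq; rewrite /GRing.scale/= ; ring.
  have d2 : is_derive x 1 (fun x => ln (p * a + q * x)) (q / (p * a + q * x)).
    by apply: is_derive_eq; rewrite /GRing.scale/= ; ring.
  by apply: is_derive_eq; rewrite /GRing.scale/=; ring.
apply: (@ger0_derive1_le_cc _ g a b).
- by move=> x /=; rewrite in_itv/= => /andP[/ltW ax _]; have [] := dg _ ax.
- move=> x /=; rewrite in_itv/= => /andP[/ltW ax _].
  rewrite derive1E; have [_ ->] := dg _ ax; have [x0 y0 z0] := pos _ ax.
  rewrite [leRHS](_ : _ = (p - q) * p * q * (x - a) ^+ 2 /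
      ((p + q) * x * (p * x + q * a) * (p * a + q * x))); last first.
    by field; rewrite !gt_eqF//= ltr_pwDl.
  apply: divr_ge0.
    by rewrite mulr_ge0 ?sqr_ge0// mulr_ge0// mulr_ge0 ?subr_ge0// ltW.
  by rewrite ltW// !mulr_gt0// ltr_pwDl.
- apply: continuous_in_subspaceT => x; rewrite inE/= in_itv/= => /andP[ax _].
  by apply: derivable_continuous_pt; have [] := dg _ ax.
- by rewrite in_itv/= lexx.
- by rewrite in_itv/= lexx andbT.
- exact: ab.
Qed.

(** * Sine transform of the sign *)

Lemma measurable_invr {R : realType} : measurable_fun [set: R] (fun x : R => x^-1).
Proof.
(* The inverse is discontinuous at 0; squaring gives a nonnegative base, on which the power -1
   agrees with the inverse. Both sides are 0 at x = 0. *)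
rewrite (_ : (fun x => _) = (fun x => x * (x ^+ 2) `^ (-1))).
  apply: measurable_funM => //.
  apply: (measurableT_comp (@measurable_powR R (-1))).
  exact: measurable_funX.
apply/funext => x; rewrite powR_inv1 ?sqr_ge0//.
have [->|x0] := eqVneq x 0; first by rewrite mul0r invr0.
by rewrite expr2 invfM mulrA divff// mul1r.
Qed.

(** Only an inequality, because the left-hand side is 0 when b = 0. *)
Lemma integral_cauchy_abs {R : realType} (b : R) :
  (\int[@lebesgue_measure R]_(l in `]0%R, +oo[)
     `|(b / (b ^+ 2 + l ^+ 2))%:E| <= (pi / 2)%:E)%E.
Proof.
under eq_integral => l _.
  rewrite abse_EFin normrM normfV (ger0_norm (_ : 0 <= b ^+ 2 + l ^+ 2)).
    rewrite -(real_normK (num_real b)); over.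
  by rewrite addr_ge0 ?sqr_ge0.
have [->|b0] := eqVneq b 0.
  rewrite integral0_eq ?lee_fin ?divr_ge0 ?pi_ge0// => l _.
  by rewrite normr0 mul0r.
by rewrite integral_cauchy ?normr_gt0.
Qed.

Lemma integrable_cauchy {R : realType} (b : R) :
  (@lebesgue_measure R).-integrable `]0, +oo[
    (fun l => (b / (b ^+ 2 + l ^+ 2))%:E).
Proof.
apply/integrableP; split.
  apply/measurable_EFinP/measurable_funTS/measurable_funM => //.
  by apply: (measurableT_comp measurable_invr); exact: measurable_funD.
exact: le_lt_trans (integral_cauchy_abs b) (ltry _).
Qed.

(** Writing b = sg(b) |b| reduces this to the positive case; the convention sg(0) = 0 covers b = 0.
    This is the integral representation of the sign on which the sine transform rests. *)
Lemma integral_cauchy_sg {R : realType} (b : R) :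
  (\int[@lebesgue_measure R]_(l in `]0%R, +oo[)
     (b / (b ^+ 2 + l ^+ 2))%:E = (pi / 2 * Num.sg b)%:E)%E.
Proof.
have [->|b0] := eqVneq b 0.
  by rewrite sgr0 mulr0 integral0_eq// => l _; rewrite mul0r.
under eq_integral => l _.
  rewrite -(real_normK (num_real b)) {1}(numEsg b) -mulrA EFinM; over.
rewrite integralZl//; last exact: integrable_cauchy.
by rewrite integral_cauchy ?normr_gt0// -EFinM mulrC.
Qed.

Lemma probability_bounded_integrable {d : measure_display} {T : measurableType d}
  {R : realType} (P : probability T R) (h : T -> R) (C : R) :
  measurable_fun setT h -> (forall w, `|h w| <= C) ->
  P.-integrable setT (EFin \o h).
Proof.
move=> mh hC; apply: measurable_bounded_integrable => //.
  exact: le_lt_trans (probability_le1 P measurableT) (ltry _).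
exists C; split; first exact: num_real.
by move=> x Cx y _; exact: le_trans (hC y) (ltW Cx).
Qed.

Section sine_transform.
Context {d : measure_display} {T : measurableType d} {R : realType}.
Variables (P : probability T R) (g B : T -> R).
Hypotheses (mg : measurable_fun setT g) (mB : measurable_fun setT B).
Hypothesis g1 : forall w, `|g w| <= 1.

Let mT := (@measurableTypeR R).
Let G (u : R) : \bar R := (\int[P]_w (g w * sin (u * B w))%:E)%E.

Let gsin1 u w : `|g w * sin (u * B w)| <= 1.
Proof.
rewrite normrM mulr_ile1//; by rewrite ler_norml sin_geN1 sin_le1.
Qed.

Let mgsin : measurable_fun setT (fun z : mT * T => g z.2 * sin (z.1 * B z.2)).
Proof.
apply: measurable_funM; first exact: measurableT_comp.
apply: (measurableT_comp measurable_sin); apply: measurable_funM => //.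
exact: measurableT_comp.
Qed.

Let igsin u : P.-integrable setT (fun w => (g w * sin (u * B w))%:E).
Proof.
apply: (probability_bounded_integrable P _ (gsin1 u)).
apply: measurable_funM => //.
by apply: (measurableT_comp measurable_sin); apply: measurable_funM.
Qed.

(** Adding 1 makes the integrand nonnegative, so that Tonelli gives measurability; the added
    constant integrates to 1 and is subtracted again. *)
Lemma measurable_sine_transform : measurable_fun [set: mT] G.
Proof.
have H : measurable_fun [set: mT]
    (fun u : mT => \int[P]_w (1 + g w * sin (u * B w))%:E)%E.
  apply: (measurable_fun_fubini_tonelli_F
    (fun z : mT * T => (1 + g z.2 * sin (z.1 * B z.2))%:E)).
    by apply/measurable_EFinP; exact: measurable_funD.
  move=> z; rewrite lee_fin -lerBlDl sub0r.
  by have := gsin1 z.1 z.2; rewrite ler_norml => /andP[].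
rewrite (_ : G = (fun u : mT => \int[P]_w (1 + g w * sin (u * B w))%:E - 1)%E).
  exact: emeasurable_funB.
apply/funext => u; under eq_integral do rewrite EFinD.
rewrite integralD//; last first.
  exact: finite_measure_integrable_cst.
by rewrite integral_cst//= probability_setT mule1 addeAC subee// add0e.
Qed.

(** [integral_expRNM_sin] is inserted under the expectation and the integrals are exchanged. The
    damping factor exp(-l u) bounds the inner absolute integral by 1/l uniformly in [w]. *)
Lemma laplace_sine_transform (l : R) : 0 < l ->
  (\int[P]_w (g w * (B w / (B w ^+ 2 + l ^+ 2)))%:E =
   \int[@lebesgue_measure R]_(u in `]0%R, +oo[) ((expR (- (l * u)))%:E * G u))%E.
Proof.
move=> l0.
pose f (z : T * mT) := (g z.1 * (expR (- (l * z.2)) * sin (z.2 * B z.1)))%:E.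
transitivity (\int[P]_(w in setT)
    \int[@lebesgue_measure R]_(u in `]0%R, +oo[) f (w, u))%E.
  apply: eq_integral => w _; rewrite /f/=.
  under eq_integral do rewrite EFinM.
  rewrite integralZl//; last exact: integrable_expRNM_sin.
  by rewrite integral_expRNM_sin.
apply: etrans.
  apply: (@Fubini_in_bounded _ _ _ _ _ P (@lebesgue_measure R) _ _ _ _ f l^-1) => //.
- apply/measurable_EFinP/measurable_funTS/measurable_funM; first exact: measurableT_comp.
  apply: measurable_funM.
    by apply: measurableT_comp => //; apply: measurable_funN; exact: measurable_funM.
  apply: (measurableT_comp measurable_sin); apply: measurable_funM => //.
  exact: measurableT_comp.
- exact: le_lt_trans (probability_le1 P measurableT) (ltry _).
- move=> w _; rewrite -(integral_expRNM l0); apply: ge0_le_integral => //.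
  + apply: measurableT_comp => //; rewrite /f/=; apply/measurable_EFinP.
    apply: measurable_funTS; apply: measurable_funM => //; apply: measurable_funM.
      by apply: measurableT_comp => //; apply: measurable_funN; exact: measurable_funM.
    by apply: (measurableT_comp measurable_sin); exact: measurable_funM.
  + apply/measurable_EFinP/measurable_funTS; apply: measurableT_comp => //.
    by apply: measurable_funN; exact: measurable_funM.
  + move=> u _; rewrite lee_fin /f/= mulrCA normrM ger0_norm ?expR_ge0//.
    by rewrite ler_piMr ?expR_ge0.
apply: eq_integral => u _; rewrite /f/= /G -integralZl//.
by apply: eq_integral => w _; rewrite -EFinM mulrCA.
Qed.

(** The Laplace identity is integrated over l > 0. On the left, [integral_cauchy_sg] produces the
    sign, with inner integrals bounded by pi/2. On the right, the integral of exp(-l u) in l is 1/u;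
    that exchange uses Tonelli, hence the sign condition on [G]. *)
Lemma sg_sine_transform :
  (forall u : R, (0 < u)%R -> 0 <= G u)%E ->
  (\int[P]_w (pi / 2 * (g w * Num.sg (B w)))%:E =
   \int[@lebesgue_measure R]_(u in `]0%R, +oo[) ((u^-1)%:E * G u))%E.
Proof.
move=> G0.
pose f (z : T * mT) := (g z.1 * (B z.1 / (B z.1 ^+ 2 + z.2 ^+ 2)))%:E.
transitivity (\int[P]_(w in setT)
    \int[@lebesgue_measure R]_(l in `]0%R, +oo[) f (w, l))%E.
  apply: eq_integral => w _; rewrite /f/=.
  under eq_integral do rewrite EFinM.
  rewrite integralZl//; last exact: integrable_cauchy.
  by rewrite integral_cauchy_sg -EFinM mulrCA.
apply: etrans.
  apply: (@Fubini_in_bounded _ _ _ _ _ P (@lebesgue_measure R) _ _ _ _ f (pi / 2)) => //.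
- apply/measurable_EFinP/measurable_funTS/measurable_funM; first exact: measurableT_comp.
  apply: measurable_funM; first exact: measurableT_comp.
  apply: (measurableT_comp measurable_invr); apply: measurable_funD => //.
    by apply: measurable_funX; exact: measurableT_comp.
  exact: measurable_funX.
- exact: le_lt_trans (probability_le1 P measurableT) (ltry _).
- move=> w _; apply: le_trans (integral_cauchy_abs (B w)).
  apply: ge0_le_integral => //.
  + apply: measurableT_comp => //; rewrite /f/=; apply/measurable_EFinP.
    apply: measurable_funTS; apply: measurable_funM => //; apply: measurable_funM => //.
    by apply: (measurableT_comp measurable_invr); exact: measurable_funD.
  + apply: measurableT_comp => //; apply/measurable_EFinP; apply: measurable_funTS.
    apply: measurable_funM => //.
    by apply: (measurableT_comp measurable_invr); exact: measurable_funD.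
  + move=> u _; rewrite lee_fin /f/= normrM ler_piMl//. 
under eq_integral => l.
  rewrite inE/= in_itv/= andbT => l0; rewrite /f/= laplace_sine_transform//; over.
pose h (z : mT * mT) := ((expR (- (z.1 * z.2)))%:E * G z.2)%E.
apply: etrans.
  apply: (@fubini_tonelli_in _ _ _ _ _ (@lebesgue_measure R) (@lebesgue_measure R)
    _ _ _ _ h) => //.
  - apply: measurable_funTS; apply: emeasurable_funM.
      apply/measurable_EFinP; apply: measurableT_comp => //.
      by apply: measurable_funN; exact: measurable_funM.
    exact: (measurableT_comp measurable_sine_transform).
  - move=> x y _ /=; rewrite in_itv/= andbT => y0.
    by rewrite mule_ge0 ?lee_fin ?expR_ge0// G0.
apply: eq_integral => u; rewrite inE/= in_itv/= andbT => u0; rewrite /h/=.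
rewrite ge0_integralZr//.
- by under eq_integral do rewrite mulrC; rewrite integral_expRNM.
- apply/measurable_EFinP/measurable_funTS; apply: measurableT_comp => //.
  by apply: measurable_funN; exact: measurable_funM.
- exact: G0.
Qed.
End sine_transform.

Lemma measurable_sgr {R : realType} : measurable_fun [set: R] (@Num.sg R).
Proof.
apply: nondecreasing_measurable => // x y.
by case: (sgrP x) => x0; case: (sgrP y) => y0 xy; lra.
Qed.

(** [sg_sine_transform] is used twice: first to replace sg(B) under the weight sin(u A), then to
    replace sg(A) under the weight sg(B). *)
Lemma sg_sg_transform {d : measure_display} {T : measurableType d} {R : realType}
    (P : probability T R) (A B : T -> R) (Phi : R -> R -> R) :
  measurable_fun setT A -> measurable_fun setT B ->
  (forall u, measurable_fun setT (Phi u)) ->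
  (forall u v : R, 0 < u -> 0 < v -> 0 <= Phi u v) ->
  (forall u v : R, 0 < u -> 0 < v ->
    (\int[P]_w (sin (u * A w) * sin (v * B w))%:E = (Phi u v)%:E)%E) ->
  (\int[P]_w ((pi / 2) ^+ 2 * (Num.sg (A w) * Num.sg (B w)))%:E =
   \int[@lebesgue_measure R]_(u in `]0%R, +oo[)
     \int[@lebesgue_measure R]_(m in `]0%R, +oo[)
       (u^-1 * (m^-1 * Phi u (u * m)))%:E)%E.
Proof.
move=> mA mB mPhi Phi0 PhiE.
have sgB1 w : `|Num.sg (B w)| <= 1 by rewrite normr_sg lern1 leq_b1.
have msgB : measurable_fun setT (fun w => Num.sg (B w)).
  exact: (measurableT_comp measurable_sgr).
pose G u : \bar R := (\int[P]_w (Num.sg (B w) * sin (u * A w))%:E)%E.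
have iG u : P.-integrable setT (fun w => (Num.sg (B w) * sin (u * A w))%:E).
  apply: (probability_bounded_integrable P (C := 1)).
    apply: measurable_funM => //.
    by apply: (measurableT_comp measurable_sin); exact: measurable_funM.
  by move=> w; rewrite normrM mulr_ile1// ler_norml sin_geN1 sin_le1.
have GE u : 0 < u -> ((pi / 2)%:E * G u =
    \int[@lebesgue_measure R]_(m in `]0%R, +oo[) (m^-1 * Phi u (u * m))%:E)%E.
  move=> u0.
  (* For u > 0 the variable u B has the sign of B. Transforming u B rather than B makes the inner
     variable the ratio m = v/u, with no change of variables. *)
  have := @sg_sine_transform _ _ _ P (fun w => sin (u * A w)) (fun w => u * B w).
  rewrite -integralZl// => H.
  transitivity (\int[P]_w (pi / 2 * (sin (u * A w) * Num.sg (u * B w)))%:E)%E.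
    apply: eq_integral => w _; rewrite -EFinM sgrM (gtr0_sg u0) mul1r.
    by rewrite [Num.sg _ * _]mulrC.
  have E m : 0 < m -> (\int[P]_w (sin (u * A w) * sin (m * (u * B w)))%:E =
      (Phi u (u * m))%:E)%E.
    move=> m0; rewrite -PhiE// ?mulr_gt0//.
    by apply: eq_integral => w _; rewrite mulrA [m * u]mulrC.
  rewrite H.
  - apply: eq_integral => m; rewrite inE/= in_itv/= andbT => m0.
    by rewrite E.
  - by apply: (measurableT_comp measurable_sin); exact: measurable_funM.
  - exact: measurable_funM.
  - by move=> w; rewrite ler_norml sin_geN1 sin_le1.
  - by move=> m m0; rewrite E// lee_fin Phi0// mulr_gt0.
have pi20 : 0 < pi / 2 :> R by rewrite divr_gt0 ?pi_gt0.
(* The sign condition of the second application follows from the first one: by [GE], (pi/2) G u is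
   the integral of a nonnegative function. *)
have G0 u : 0 < u -> (0 <= G u)%E.
  move=> u0; rewrite -(@pmule_rge0 _ (pi / 2)%:E) ?lte_fin// GE//.
  apply: integral_ge0 => m /=; rewrite in_itv/= andbT => m0.
  by rewrite lee_fin mulr_ge0 ?invr_ge0 ?Phi0 ?mulr_gt0// ltW.
transitivity ((pi / 2)%:E * \int[P]_w (pi / 2 * (Num.sg (B w) * Num.sg (A w)))%:E)%E.
  rewrite -integralZl//.
    apply: eq_integral => w _; rewrite -EFinM; congr (_%:E); ring.
  apply: (probability_bounded_integrable P (C := pi / 2)).
    apply: measurable_funM => //; apply: measurable_funM => //.
    exact: (measurableT_comp measurable_sgr).
  move=> w; rewrite normrM (gtr0_norm pi20) ler_piMr ?(ltW pi20)//.
  by rewrite normrM mulr_ile1// normr_sg lern1 leq_b1.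
rewrite sg_sine_transform// -ge0_integralZl//.
- apply: eq_integral => u; rewrite inE/= in_itv/= andbT => u0.
  rewrite muleCA GE// -ge0_integralZl//.
  + apply/measurable_EFinP; apply: measurable_funTS; apply: measurable_funM.
      exact: measurable_invr.
    by apply: (measurableT_comp (mPhi u)); exact: measurable_funM.
  + move=> m /=; rewrite in_itv/= andbT => m0.
    by rewrite lee_fin mulr_ge0 ?invr_ge0 ?Phi0 ?mulr_gt0// ltW.
  + by rewrite lee_fin invr_ge0 ltW.
- apply: emeasurable_funM.
    apply/measurable_EFinP; apply: measurable_funTS; exact: measurable_invr.
  by apply: measurable_funTS; exact: measurable_sine_transform.
- by move=> u /=; rewrite in_itv/= andbT => u0; rewrite mule_ge0 ?G0// lee_fin invr_ge0 ltW.
- by rewrite lee_fin ltW.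
Qed.

(** * Ratio of two symmetric stable variables *)

Section radial_comparison.
Context {R : realType}.
Variable alpha : R.
Hypothesis alpha0 : 0 < alpha.
Implicit Types p q u v m : R.

(* [E (sin (u A) sin (v B))] for [A = Y - c S] and [B = Y + c S], where [Y] and
   [S] are independent, [Y / p^(1/alpha)] and [S] are [S(alpha,1)], [q = c^alpha]. *)
Definition sine_corr p q u v : R := 2^-1 *
  (expR (- (p * `|u - v| `^ alpha + q * (u + v) `^ alpha)) -
   expR (- (p * (u + v) `^ alpha + q * `|u - v| `^ alpha))).

Let mT := (@measurableTypeR R).
(** The pair is (m, u): the ratio comes first and the radius second, so that the inner integral of
    [radial] runs over u. *)
Let k p q (z : mT * mT) : R := z.2^-1 * (z.1^-1 * sine_corr p q z.2 (z.2 * z.1)).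

Lemma measurable_sine_corr p q u : measurable_fun setT (sine_corr p q u).
Proof.
have m1 : measurable_fun [set: R] (fun v => `|u - v| `^ alpha).
  apply: (measurableT_comp (@measurable_powR R alpha)).
  by apply: measurableT_comp => //; exact: measurable_funB.
have m2 : measurable_fun [set: R] (fun v => (u + v) `^ alpha).
  apply: (measurableT_comp (@measurable_powR R alpha)).
  exact: measurable_funD.
apply: measurable_funM => //; apply: measurable_funB;
  apply: measurableT_comp => //; apply: measurable_funN;
  by apply: measurable_funD; exact: measurable_funM.
Qed.

(** Rearrangement: |u - v|^alpha <= (u + v)^alpha and q <= p, so pairing the larger weight with the
    larger power gives the larger exponent. *)
Lemma sine_corr_ge0 p q u v : 0 <= q <= p -> 0 < u -> 0 < v ->
  0 <= sine_corr p q u v.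
Proof.
move=> /andP[q0 qp] u0 v0; rewrite mulr_ge0// subr_ge0 ler_expR lerN2.
have : `|u - v| `^ alpha <= (u + v) `^ alpha.
  apply: ge0_ler_powR; rewrite ?nnegrE ?(ltW alpha0)//; first lra.
  by rewrite ler_norml; apply/andP; split; lra.
by nra.
Qed.

Let mk p q : measurable_fun setT (EFin \o k p q).
Proof.
apply/measurable_EFinP; rewrite /k.
have m2 : measurable_fun setT (fun z : mT * mT => z.2 * z.1) by exact: measurable_funM.
have m1 : measurable_fun setT (fun z : mT * mT => `|z.2 - z.2 * z.1| `^ alpha).
  apply: (measurableT_comp (@measurable_powR R alpha)).
  by apply: measurableT_comp => //; exact: measurable_funB.
have m3 : measurable_fun setT (fun z : mT * mT => (z.2 + z.2 * z.1) `^ alpha).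
  apply: (measurableT_comp (@measurable_powR R alpha)).
  exact: measurable_funD.
apply: measurable_funM; first exact: (measurableT_comp measurable_invr).
apply: measurable_funM; first exact: (measurableT_comp measurable_invr).
apply: measurable_funM => //; apply: measurable_funB;
  apply: measurableT_comp => //; apply: measurable_funN;
  by apply: measurable_funD; exact: measurable_funM.
Qed.

Let k_ge0 p q m u : 0 <= q <= p -> 0 < m -> 0 < u -> (0 <= (k p q (m, u))%:E)%E.
Proof.
move=> qp m0 u0; rewrite lee_fin /k/=.
by rewrite mulr_ge0 ?invr_ge0 ?(ltW u0)// mulr_ge0 ?invr_ge0 ?(ltW m0)//
  sine_corr_ge0// mulr_gt0.
Qed.

Let radial p q m : \bar R :=
  (\int[@lebesgue_measure R]_(u in `]0%R, +oo[) (k p q (m, u))%:E)%E.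

(** By homogeneity both exponents are constants times u^alpha, so [frullani_powR] applies. At m = 1
    one of these constants would be 0 when q = 0, and the integral would diverge. *)
Let radialE p q m : 0 < p -> 0 <= q <= p -> 0 < m -> m != 1 ->
  radial p q m = (m^-1 * (2^-1 * (alpha^-1 *
    (ln (p * (1 + m) `^ alpha + q * `|1 - m| `^ alpha) -
     ln (p * `|1 - m| `^ alpha + q * (1 + m) `^ alpha)))))%:E.
Proof.
move=> p0 qp m0 m1; have /andP[q0 _] := qp.
have a0 : 0 < `|1 - m| `^ alpha.
  by rewrite powR_gt0// normr_gt0 subr_eq0 eq_sym.
have ab : `|1 - m| `^ alpha <= (1 + m) `^ alpha.
  apply: ge0_ler_powR; rewrite ?nnegrE ?(ltW alpha0)//; first lra.
  by rewrite ler_norml; apply/andP; split; lra.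
set a := _ `^ _ in a0 ab *; set b := (1 + m) `^ alpha in ab *.
rewrite /radial; under eq_integral => u.
  rewrite inE/= in_itv/= andbT => u0.
  rewrite (_ : k p q (m, u) = m^-1 * 2^-1 * (u^-1 *
    (expR (- ((p * a + q * b) * u `^ alpha)) -
     expR (- ((p * b + q * a) * u `^ alpha))))); last first.
    rewrite /k/= /sine_corr.
    have -> : u - u * m = u * (1 - m) by ring.
    have -> : u + u * m = u * (1 + m) by ring.
    rewrite normrM (gtr0_norm u0) !powRM ?(ltW u0) ?addr_ge0 ?(ltW m0)//.
    rewrite -/a -/b.
    have -> : p * (u `^ alpha * a) + q * (u `^ alpha * b) =
      (p * a + q * b) * u `^ alpha by ring.
    have -> : p * (u `^ alpha * b) + q * (u `^ alpha * a) =
      (p * b + q * a) * u `^ alpha by ring.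
    by ring.
  rewrite EFinM; over.
have pq : p * a + q * b <= p * b + q * a by have /andP[_] := qp; nra.
have c0 : 0 < p * a + q * b.
  by rewrite ltr_pwDl ?mulr_gt0// mulr_ge0// powR_ge0.
rewrite ge0_integralZl_EFin//.
- by rewrite frullani_powR// -EFinM !mulrA.
- move=> u /=; rewrite in_itv/= andbT => u0.
  rewrite lee_fin mulr_ge0 ?invr_ge0 ?(ltW u0)//.
  by rewrite subr_ge0 ler_expR lerN2 ler_wpM2r ?powR_ge0.
- apply/measurable_EFinP; apply: measurable_funTS; apply: measurable_funM.
    exact: measurable_invr.
  apply: measurable_funB; apply: measurableT_comp => //; apply: measurable_funN;
    by apply: measurable_funM => //; exact: measurable_powR.
- by rewrite mulr_ge0 ?invr_ge0 ?(ltW m0).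
Qed.

(** After Tonelli the radial integrals are compared for each m by [ln_ratio_le]. For p = 1 and q = 0
    the logarithmic factor is ln b - ln a, which is the right-hand side of that inequality up to (p
    - q)/(p + q). *)
Lemma radial_comparison p q : 0 < p -> 0 <= q <= p ->
  (\int[@lebesgue_measure R]_(u in `]0%R, +oo[)
     \int[@lebesgue_measure R]_(m in `]0%R, +oo[)
       (u^-1 * (m^-1 * sine_corr p q u (u * m)))%:E <=
   ((p - q) / (p + q))%:E *
   \int[@lebesgue_measure R]_(u in `]0%R, +oo[)
     \int[@lebesgue_measure R]_(m in `]0%R, +oo[)
       (u^-1 * (m^-1 * sine_corr 1 0 u (u * m)))%:E)%E.
Proof.
move=> p0 qp.
have swap p' q' : 0 <= q' <= p' ->
    (\int[@lebesgue_measure R]_(u in `]0%R, +oo[)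
     \int[@lebesgue_measure R]_(m in `]0%R, +oo[)
       (u^-1 * (m^-1 * sine_corr p' q' u (u * m)))%:E =
     \int[@lebesgue_measure R]_(m in `]0%R, +oo[) radial p' q' m)%E.
  move=> qp'; apply/esym.
  apply: (@fubini_tonelli_in _ _ _ _ _ (@lebesgue_measure R) (@lebesgue_measure R)
    _ _ _ _ (EFin \o k p' q')) => //.
    exact: measurable_funTS.
  move=> m u /=; rewrite !in_itv/= !andbT; exact: k_ge0.
have mrad p' q' : 0 <= q' <= p' ->
    measurable_fun (`]0%R, +oo[%classic : set mT) (radial p' q').
  move=> qp'; apply: (@measurable_fun_fubini_in _ _ _ _ _ (@lebesgue_measure R)
    _ _ _ _ (EFin \o k p' q')) => //.
    exact: measurable_funTS.
  move=> m u /=; rewrite !in_itv/= !andbT; exact: k_ge0.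
have rad0 p' q' m : 0 <= q' <= p' -> 0 < m -> (0 <= radial p' q' m)%E.
  move=> qp' m0; apply: integral_ge0 => u /=; rewrite in_itv/= andbT.
  exact: k_ge0.
have qp1 : (0 : R) <= 0 <= (1 : R) by rewrite lexx ler01.
have r0 : 0 <= (p - q) / (p + q).
  by have /andP[q0 ?] := qp; rewrite divr_ge0 ?subr_ge0// addr_ge0// ltW.
rewrite [X in (X <= _)%E](swap _ _ qp).
rewrite [X in (_ * X)%E](swap _ _ qp1).
rewrite -ge0_integralZl//; [|exact: mrad|]; last first.
  by move=> m /=; rewrite in_itv/= andbT; exact: rad0.
apply: ae_ge0_le_integral => //.
- by move=> m /=; rewrite in_itv/= andbT; exact: rad0.
- exact: mrad.
- move=> m /=; rewrite in_itv/= andbT => m0.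
  by rewrite mule_ge0 ?rad0// lee_fin.
- by apply: emeasurable_funM => //; exact: mrad.
exists [set 1]; split; [exact: measurable_set1|exact: lebesgue_measure_set1|].
move=> m /=; apply: contra_notP => /eqP m1.
rewrite in_itv/= andbT => m0.
rewrite !radialE// -EFinM lee_fin.
rewrite !mul1r !mul0r !addr0 [leRHS]mulrCA ler_pM2l ?invr_gt0//.
rewrite [leRHS]mulrCA ler_pM2l ?invr_gt0// [leRHS]mulrCA ler_pM2l ?invr_gt0//.
apply: ln_ratio_le => //; first by rewrite powR_gt0// normr_gt0 subr_eq0 eq_sym.
apply: ge0_ler_powR; rewrite ?nnegrE ?(ltW alpha0)//; first lra.
by rewrite ler_norml; apply/andP; split; lra.
Qed.

End radial_comparison.

Lemma sinM_cos {R : realType} (a b : R) :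
  sin a * sin b = 2^-1 * (cos (a - b) - cos (a + b)).
Proof. by rewrite cosB cosD; field. Qed.

Section stable_ratio.
Context {d : measure_display} {T : measurableType d} {R : realType}.
Variables (P : probability T R) (alpha p c : R) (Y S : T -> R).
Hypotheses (alpha0 : 0 < alpha) (p0 : 0 < p) (c0 : 0 < c).
Hypothesis qp : c `^ alpha <= p.
Hypotheses (mY : measurable_fun setT Y) (mS : measurable_fun setT S).
Hypothesis cfYS : forall a b : R,
  (\int[P]_w (cos (a * Y w + b * S w))%:E =
   (expR (- (p * `|a| `^ alpha + `|b| `^ alpha)))%:E)%E.

(** The product-to-sum formula leaves two cosines of linear combinations of [Y] and [S], whose means
    are given by [cfYS]. *)
Let integral_sinM (a b a' b' : R) :
  (\int[P]_w (sin (a * Y w + b * S w) * sin (a' * Y w + b' * S w))%:E =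
   (2^-1 *
     (expR (- (p * `|a - a'| `^ alpha + `|b - b'| `^ alpha)) -
      expR (- (p * `|a + a'| `^ alpha + `|b + b'| `^ alpha))))%:E)%E.
Proof.
have icos x y : P.-integrable setT (fun w => (cos (x * Y w + y * S w))%:E).
  apply: (probability_bounded_integrable P (C := 1)).
    apply: (measurableT_comp measurable_cos).
    by apply: measurable_funD; exact: measurable_funM.
  by move=> w; rewrite ler_norml cos_geN1 cos_le1.
under eq_integral => w _.
  rewrite sinM_cos.
  have -> : a * Y w + b * S w - (a' * Y w + b' * S w) =
    (a - a') * Y w + (b - b') * S w by ring.
  have -> : a * Y w + b * S w + (a' * Y w + b' * S w) =
    (a + a') * Y w + (b + b') * S w by ring.
  rewrite EFinM EFinB; over.
rewrite integralZl//; last exact: integrableB.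
by rewrite integralB// !cfYS -EFinB -EFinM.
Qed.

Let msin (a b : R) : measurable_fun setT (fun w => a * Y w + b * S w).
Proof. by apply: measurable_funD; exact: measurable_funM. Qed.

Let pi20 : 0 < (pi / 2) ^+ 2 :> R.
Proof. by rewrite exprn_gt0// divr_gt0 ?pi_gt0. Qed.

Let isg (A B : T -> R) : measurable_fun setT A -> measurable_fun setT B ->
  P.-integrable setT (fun w => (Num.sg (A w) * Num.sg (B w))%:E).
Proof.
move=> mA mB; apply: (probability_bounded_integrable P (C := 1)).
  by apply: measurable_funM; exact: (measurableT_comp measurable_sgr).
by move=> w; rewrite normrM mulr_ile1// normr_sg lern1 leq_b1.
Qed.

(** The double integral is (pi/2)^2 times the mean of sg(S)^2, and a squared sign is at most 1. *)
Let reference : (\int[@lebesgue_measure R]_(u in `]0%R, +oo[)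
     \int[@lebesgue_measure R]_(m in `]0%R, +oo[)
       (u^-1 * (m^-1 * sine_corr alpha 1 0 u (u * m)))%:E <=
    ((pi / 2) ^+ 2)%:E)%E.
Proof.
rewrite -(@sg_sg_transform _ _ _ P S S (sine_corr alpha 1 0))//.
- under eq_integral do rewrite EFinM.
  rewrite integralZl//; last exact: isg.
  rewrite -[leRHS]mule1 lee_pmul2l ?lte_fin//.
  apply: (@le_trans _ _ (\int[P]_w 1)%E).
    apply: le_integral => //; first exact: isg.
      exact: finite_measure_integrable_cst.
    move=> w _; rewrite lee_fin.
    by case: (sgrP (S w)) => _; rewrite ?(mulr0, mulr1, mulN1r, opprK) ?ler01.
  by rewrite integral_cst//= probability_setT mule1.
- by move=> u; exact: measurable_sine_corr.
- by move=> u v u0 v0; apply: sine_corr_ge0 => //; rewrite lexx ler01.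
- move=> u v u0 v0; have := integral_sinM 0 u 0 v.
  under eq_integral do rewrite !mul0r !add0r.
  move=> ->; rewrite /sine_corr subr0 addr0 normr0 powR0 ?gt_eqF// mulr0 !add0r.
  by rewrite !mul0r !addr0 !mul1r (gtr0_norm (addr_gt0 u0 v0)).
Qed.

Let A w := 1 * Y w + (- c) * S w.
Let B w := 1 * Y w + c * S w.

(** Both sides are multiplied by (pi/2)^2; [radial_comparison] then bounds the transform by (p -
    q)/(p + q) times the integral in [reference], with q = c^alpha. *)
Let sg_corr : (\int[P]_w (Num.sg (A w) * Num.sg (B w))%:E <=
  ((p - c `^ alpha) / (p + c `^ alpha))%:E)%E.
Proof.
have q0 : 0 <= c `^ alpha <= p by rewrite powR_ge0.
have r0 : 0 <= (p - c `^ alpha) / (p + c `^ alpha).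
  by rewrite divr_ge0 ?subr_ge0// addr_ge0 ?powR_ge0// ltW.
rewrite -(@lee_pmul2l _ ((pi / 2) ^+ 2)%:E) ?lte_fin// -integralZl//; last first.
  by apply: isg; exact: msin.
under eq_integral do rewrite -EFinM.
rewrite (@sg_sg_transform _ _ _ P A B (sine_corr alpha p (c `^ alpha)))//; try exact: msin.
- apply: (le_trans (radial_comparison alpha0 p0 q0)).
  by rewrite muleC lee_wpmul2r// ?lee_fin.
- by move=> u; exact: measurable_sine_corr.
- by move=> u v u0 v0; exact: sine_corr_ge0.
(* The coefficients of [S] in u A and v B have opposite signs. Hence u - v for [Y] is accompanied by
   u + v for [S], and conversely, which is the crossing in [sine_corr]. *)
- move=> u v u0 v0; have := integral_sinM u (- (c * u)) v (c * v).
  under eq_integral => w _.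
    rewrite (_ : u * Y w + - (c * u) * S w = u * A w); last by rewrite /A; ring.
    rewrite (_ : v * Y w + c * v * S w = v * B w); last by rewrite /B; ring.
    over.
  move=> ->; rewrite /sine_corr.
  have -> : - (c * u) - c * v = - (c * (u + v)) by ring.
  have -> : - (c * u) + c * v = - (c * (u - v)) by ring.
  have nc z : `|- (c * z)| `^ alpha = c `^ alpha * `|z| `^ alpha.
    by rewrite normrN normrM (gtr0_norm c0) powRM ?(ltW c0).
  by rewrite !nc (gtr0_norm (addr_gt0 u0 v0)).
Qed.

Lemma measurable_scaled_norm_lt : measurable [set w | c * `|S w| < `|Y w|].
Proof.
have mcS : measurable_fun setT (fun w => c * `|S w|).
  by apply: measurable_funM => //; exact: measurableT_comp.
have mnY : measurable_fun setT (fun w => `|Y w|) by exact: measurableT_comp.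
rewrite -[X in measurable X]setTI.
exact: (measurable_fun_ltr mcS mnY measurableT (Y := [set true])).
Qed.

(** Since A B = Y^2 - c^2 S^2, the indicator of the event is at most (1 + sg(A) sg(B))/2; on the tie
    |Y| = c |S| the latter is 1/2. With q = c^alpha, half of 1 + (p - q)/(p + q) is p/(p + q). *)
Lemma stable_ratio_prob :
  (P [set w | (c * `|S w| < `|Y w|)%R] <= (p / (p + c `^ alpha))%:E)%E.
Proof.
have mE := measurable_scaled_norm_lt.
rewrite -[X in P X]setIT -integral_indic//.
apply: (@le_trans _ _ (\int[P]_w (2^-1 * (1 + Num.sg (A w) * Num.sg (B w)))%:E)%E).
  apply: ge0_le_integral => //.
  - exact/measurable_EFinP/measurable_indic.
  - apply/measurable_EFinP; apply: measurable_funM => //; apply: measurable_funD => //.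
    by apply: measurable_funM; apply: (measurableT_comp measurable_sgr); exact: msin.
  - move=> w _; rewrite lee_fin indicE -sgrM.
    have -> : A w * B w = `|Y w| ^+ 2 - (c * `|S w|) ^+ 2.
      by rewrite exprMn !real_normK ?num_real// /A /B; ring.
    have cS0 : 0 <= c * `|S w| by rewrite mulr_ge0// ltW.
    case: (boolP (w \in _)) => [|_].
      rewrite inE/= => cSY; rewrite gtr0_sg; first by lra.
      by rewrite subr_gt0 ltr_sqr ?nnegrE.
    by rewrite mulr0n; case: sgrP => _; lra.
under eq_integral do rewrite EFinM EFinD.
have i1 : P.-integrable setT (fun w : T => 1%:E : \bar R).
  exact: finite_measure_integrable_cst.
rewrite integralZl//; last by apply: integrableD => //; apply: isg; exact: msin.
rewrite integralD//; last by apply: isg; exact: msin.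
rewrite integral_cst//= probability_setT mule1.
apply: (@le_trans _ _ ((2^-1)%:E * (1 + ((p - c `^ alpha) / (p + c `^ alpha))%:E))%E).
  by rewrite lee_pmul2l ?lte_fin// leeD2l// sg_corr.
rewrite -EFinD -EFinM lee_fin.
have h : 0 < p + c `^ alpha by rewrite ltr_pwDl// powR_ge0.
rewrite le_eqVlt; apply/orP; left; apply/eqP; field.
by rewrite gt_eqF.
Qed.
End stable_ratio.

(** * Independence *)

Section independent_pi_systems.
Context {d : measure_display} {T : measurableType d} {R : realType}.
Variable P : probability T R.

(** For fixed [B], the maps A -> P(A and B) and A -> P(A) P(B) are finite measures that agree on the
    pi-system [G1], hence on the sigma-algebra it generates. *)
Let indep_g_sigma_l (G1 G2 : set (set T)) :
  G1 `<=` measurable -> G2 `<=` measurable -> setI_closed G1 -> G1 setT ->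
  (forall A B, G1 A -> G2 B -> P (A `&` B) = (P A * P B)%E) ->
  forall A B, <<s G1 >> A -> G2 B -> P (A `&` B) = (P A * P B)%E.
Proof.
move=> mG1 mG2 IG1 G1T H A B sA GB.
have mB := mG2 _ GB.
have PB0 : 0 <= fine (P B) by rewrite fine_ge0.
have PBE : (fine (P B))%:E = P B by rewrite fineK// fin_num_measure.
pose m1 := mrestr P mB.
pose m2 := mscale (NngNum PB0) P.
have -> : P (A `&` B) = m1 A by [].
have m2E C : m2 C = (P C * P B)%E by rewrite muleC -{1}PBE.
rewrite -m2E.
apply: (g_sigma_algebra_measure_unique G1 mG1 (fun=> setT)) => //.
- exact: bigcup_const.
- by move=> C GC; exact: etrans (H _ _ GC GB) (esym (m2E C)).
- move=> _; rewrite /m1 /= /mrestr setTI.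
  exact: le_lt_trans (probability_le1 P mB) (ltry _).
Qed.

Lemma indep_g_sigma (G1 G2 : set (set T)) :
  G1 `<=` measurable -> G2 `<=` measurable ->
  setI_closed G1 -> setI_closed G2 -> G1 setT -> G2 setT ->
  (forall A B, G1 A -> G2 B -> P (A `&` B) = (P A * P B)%E) ->
  forall A B, <<s G1 >> A -> <<s G2 >> B -> P (A `&` B) = (P A * P B)%E.
Proof.
move=> mG1 mG2 IG1 IG2 G1T G2T H A B sA sB.
have sm1 : <<s G1 >> `<=` measurable.
  by apply: smallest_sub => //; exact: sigma_algebra_measurable.
rewrite setIC muleC.
apply: (indep_g_sigma_l mG2 sm1 IG2 G2T _ sB sA) => C D GC sD.
by rewrite setIC muleC; exact: (indep_g_sigma_l mG1 mG2 IG1 G1T H sD GC).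
Qed.

(** Independence on measurable rectangles identifies the joint law of (U, V) with the product of the
    two laws; Fubini then factors the integral. *)
Lemma integral_indepM (U V : T -> R) (F G : R -> R) :
  measurable_fun setT U -> measurable_fun setT V ->
  (forall A B, measurable A -> measurable B ->
    P (U @^-1` A `&` V @^-1` B) = (P (U @^-1` A) * P (V @^-1` B))%E) ->
  measurable_fun setT F -> measurable_fun setT G ->
  (forall x, `|F x| <= 1) -> (forall x, `|G x| <= 1) ->
  (\int[P]_w (F (U w) * G (V w))%:E =
   \int[P]_w (F (U w))%:E * \int[P]_w (G (V w))%:E)%E.
Proof.
move=> mU mV UV mF mG F1 G1.
pose U' : {mfun T >-> R} := HB.pack U (isMeasurableFun.Build _ _ _ _ U mU).
pose V' : {mfun T >-> R} := HB.pack V (isMeasurableFun.Build _ _ _ _ V mV).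
have mW : measurable_fun setT (fun w => (U w, V w)) by exact: measurable_fun_pair.
pose W' : {mfun T >-> (R * R)%type} :=
  HB.pack (fun w => (U w, V w)) (isMeasurableFun.Build _ _ _ _ (fun w => (U w, V w)) mW).
pose f (z : R * R) := (F z.1 * G z.2)%:E.
have mf : measurable_fun setT f.
  apply/measurable_EFinP; apply: measurable_funM; exact: measurableT_comp.
have f1 z : `|F z.1 * G z.2| <= 1 by rewrite normrM mulr_ile1.
have iFU : P.-integrable setT (fun w => (F (U w))%:E).
  apply: (probability_bounded_integrable P (C := 1)) => //; exact: measurableT_comp.
have iGV : P.-integrable setT (fun w => (G (V w))%:E).
  apply: (probability_bounded_integrable P (C := 1)) => //; exact: measurableT_comp.
transitivity (\int[distribution P W']_z f z)%E.
  rewrite integral_pushforward//.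
  apply: (probability_bounded_integrable P (C := 1)) => //.
  by apply: measurable_funM; exact: measurableT_comp.
transitivity (\int[(distribution P U' \x distribution P V')%E]_z f z)%E.
  apply: eq_measure_integral => A mA _; apply/esym.
  by apply: product_measure_unique => // B C mB mC; exact: UV.
rewrite -integral12_prod_meas1; last first.
  apply: measurable_bounded_integrable => //.
  - have := product_measure1E (distribution P U') (distribution P V')
      measurableT measurableT.
    have U1 : distribution P U' setT = 1%E by exact: probability_setT.
    have V1 : distribution P V' setT = 1%E by exact: probability_setT.
    rewrite setXTT [X in (X * _)%E]U1 [X in (_ * X)%E]V1 mule1 => H.
    by apply: (@le_lt_trans _ _ 1%E); [rewrite -H|exact: ltry].
  - exact/measurable_EFinP.
  - exists 1; split; first exact: num_real.
    by move=> x x1 y _; exact: le_trans (f1 y) (ltW x1).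
rewrite /fubini_F /f/=.
transitivity (\int[distribution P U']_x ((F x)%:E * \int[P]_w (G (V w))%:E))%E.
  apply: eq_integral => x _.
  under eq_integral do rewrite EFinM.
  rewrite integralZl//.
    congr (_ * _)%E; rewrite integral_pushforward//.
    by apply/measurable_EFinP.
  exact: (probability_bounded_integrable _ mG G1).
have GVfin : (\int[P]_w (G (V w))%:E)%E \is a fin_num by exact: integrable_fin_num.
rewrite -(fineK GVfin) integralZr//; last first.
  exact: (probability_bounded_integrable _ mF F1).
congr (_ * _)%E; rewrite integral_pushforward//.
by apply/measurable_EFinP.
Qed.

End independent_pi_systems.

Section mutual_independence.
Context {d : measure_display} {T : measurableType d} {R : realType}.
Variables (P : probability T R) (I : finType) (X : I -> T -> R).
Hypothesis HX : mutually_independent P X.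
Implicit Types J : {set I}.

(** A pi-system generating the sigma-algebra of the variables indexed by [J]. The sets [B i] are
    required to be measurable at every index, which makes it easy to combine families. *)
Definition rectangles J : set (set T) :=
  [set A | exists2 B : I -> set R, (forall i, measurable (B i)) &
    A = \bigcap_(i in [set i | i \in J]) (X i @^-1` B i)].

Let measurable_rectangles J : rectangles J `<=` measurable.
Proof.
move=> _ [B mB ->]; apply: fin_bigcap_measurable => [|i _].
  exact: finite_finset.
by rewrite -[X in measurable X]setTI; exact: HX.1.
Qed.

Let rectanglesI J : setI_closed (rectangles J).
Proof.
move=> _ _ [B mB ->] [C mC ->]; exists (fun i => B i `&` C i).
  by move=> i; exact: measurableI.
by rewrite -bigcapI; apply: eq_bigcapr => i _; rewrite preimage_setI.
Qed.

Let rectanglesT J : rectangles J setT.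
Proof.
exists (fun=> setT) => //; apply/esym; rewrite -subTset => w _ i _ //.
Qed.

(** As the index sets are disjoint, the two families merge into one family [D] on their union, and
    the product formula splits accordingly. *)
Let rectangles_indep J1 J2 : {in J1, forall i, i \notin J2} ->
  forall A B, rectangles J1 A -> rectangles J2 B ->
    P (A `&` B) = (P A * P B)%E.
Proof.
move=> J12 _ _ [B mB ->] [C mC ->].
have dJ : fintype.disjoint (mem J1) (mem J2).
  apply/pred0P => i /=; apply/negbTE/negP => /andP[iJ1].
  by apply/negP; exact: J12.
have J21 i : i \in J2 -> (i \in J1) = false.
  by move=> iJ2; apply/negP => /J12; rewrite iJ2.
have [_ H] := HX.
rewrite [P (\bigcap_(i in _) _)]H// [P (\bigcap_(i in [set` J2]) _)]H//.
pose D i := if i \in J1 then B i else C i.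
have mD i : measurable (D i) by rewrite /D; case: ifP.
have -> : (\bigcap_(i in [set i | i \in J1]) (X i @^-1` B i)) `&`
    (\bigcap_(i in [set i | i \in J2]) (X i @^-1` C i)) =
    \bigcap_(i in [set i | i \in J1 :|: J2]) (X i @^-1` D i).
  apply/seteqP; split => w /=.
    move=> [w1 w2] i /=; rewrite inE /D; case: ifPn => [/w1//|_ /=]; exact: w2.
  move=> w12; split => i /= iJ.
    by have := w12 i; rewrite /= inE iJ /D iJ; exact.
  have := w12 i; rewrite /= inE iJ orbT /D (J21 _ iJ); exact.
rewrite H// (eq_bigl [predU J1 & J2]); last by move=> i; rewrite !inE.
rewrite bigU//=; congr (_ * _)%E.
  by apply: eq_bigr => i iJ; rewrite /D iJ.
by apply: eq_bigr => i iJ; rewrite /D (J21 _ iJ).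
Qed.

Lemma sub_rectangles_measurable J A : <<s rectangles J >> A -> measurable A.
Proof.
apply: smallest_sub => //; exact: sigma_algebra_measurable.
Qed.

Lemma mutually_independent_groups J1 J2 A B : {in J1, forall i, i \notin J2} ->
  <<s rectangles J1 >> A -> <<s rectangles J2 >> B ->
  P (A `&` B) = (P A * P B)%E.
Proof.
move=> J12; apply: indep_g_sigma => //; exact: rectangles_indep.
Qed.

Lemma measurable_coordinate J i : i \in J ->
  measurable_fun [set: g_sigma_algebraType (rectangles J)] (X i).
Proof.
move=> iJ _ Y mY; rewrite setTI; apply: sub_sigma_algebra.
exists (fun k => if k == i then Y else setT).
  by move=> k; case: ifP.
apply/seteqP; split => w /=; first by move=> Yw k _ /=; case: eqP => // ->.
by move=> /(_ i iJ); rewrite /= eqxx.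
Qed.

Lemma preimage_sub_rectangles J (f : T -> R) A : measurable A ->
  measurable_fun [set: g_sigma_algebraType (rectangles J)] f ->
  <<s rectangles J >> (f @^-1` A).
Proof. by move=> mA /(_ measurableT _ mA); rewrite setTI. Qed.

Lemma measurable_lincomb J (c : I -> R) (r : seq I) : {subset r <= J} ->
  measurable_fun [set: g_sigma_algebraType (rectangles J)]
    (fun w => \sum_(i <- r) c i * X i w).
Proof.
elim: r => [_|i r IH rJ].
  by under eq_fun do rewrite big_nil; exact: measurable_cst.
under eq_fun do rewrite big_cons; apply: measurable_funD.
  apply: measurable_funM; first exact: measurable_cst.
  by apply: measurable_coordinate; rewrite rJ ?mem_head.
by apply: IH => k kr; rewrite rJ// inE kr orbT.
Qed.

Lemma measurable_fun_sub_rectangles J (f : T -> R) :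
  measurable_fun [set: g_sigma_algebraType (rectangles J)] f ->
  measurable_fun setT f.
Proof.
move=> mf _ Y mY; apply: (@sub_rectangles_measurable J).
by rewrite setTI; exact: preimage_sub_rectangles.
Qed.

(** Induction with the addition formulas. The vanishing sine mean is carried along because the
    cosine of a sum involves a product of sines. *)
Lemma stable_lincomb (alpha : R) (c : I -> R) (r : seq I) :
  0 < alpha -> (forall i, sym_stable_unit P alpha (X i)) -> uniq r ->
  (\int[P]_w (cos (\sum_(i <- r) c i * X i w))%:E =
    (expR (- \sum_(i <- r) `|c i| `^ alpha))%:E)%E /\
  (\int[P]_w (sin (\sum_(i <- r) c i * X i w))%:E = 0)%E.
Proof.
move=> a0 HS; elim: r => [_|i r IH /= /andP[ir ur]].
  split.
    under eq_integral do rewrite big_nil cos0.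
    by rewrite big_nil oppr0 expR0 integral_cst//= probability_setT mule1.
  by rewrite integral0_eq// => w _; rewrite big_nil sin0.
have {IH ur} [IHc IHs] := IH ur.
have [mi /(_ (c i))[Hc Hs]] := HS i.
pose U w := c i * X i w.
pose V w := \sum_(k <- r) c k * X k w.
pose J := [set k in r]%SET.
have mU : measurable_fun [set: g_sigma_algebraType (rectangles [set i]%SET)] U.
  by apply: measurable_funM => //; apply: measurable_coordinate; rewrite inE.
have mV : measurable_fun [set: g_sigma_algebraType (rectangles J)] V.
  by apply: measurable_lincomb => k; rewrite inE.
have mU' : measurable_fun setT U by exact: measurable_funM.
have mV' : measurable_fun setT V by exact: (@measurable_fun_sub_rectangles J).
have dJ : {in [set i]%SET, forall k, k \notin J}.
  by move=> k; rewrite !inE => /eqP ->.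
have UV A B : measurable A -> measurable B ->
    P (U @^-1` A `&` V @^-1` B) = (P (U @^-1` A) * P (V @^-1` B))%E.
  move=> mA mB; apply: (mutually_independent_groups dJ);
    exact: preimage_sub_rectangles.
have M (F G : R -> R) : measurable_fun setT F -> measurable_fun setT G ->
  (forall x, `|F x| <= 1) -> (forall x, `|G x| <= 1) ->
  (\int[P]_w (F (U w) * G (V w))%:E =
   \int[P]_w (F (U w))%:E * \int[P]_w (G (V w))%:E)%E.
  exact: integral_indepM.
have sin1 x : `|@sin R x| <= 1 by rewrite ler_norml sin_geN1 sin_le1.
have cos1 x : `|@cos R x| <= 1 by rewrite ler_norml cos_geN1 cos_le1.
have iM (F G : R -> R) : measurable_fun setT F -> measurable_fun setT G ->
  (forall x, `|F x| <= 1) -> (forall x, `|G x| <= 1) ->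
  P.-integrable setT (fun w => (F (U w) * G (V w))%:E).
  move=> mF mG F1 G1; apply: (probability_bounded_integrable P (C := 1)).
    by apply: measurable_funM; exact: measurableT_comp.
  by move=> w; rewrite normrM mulr_ile1.
have [ms mc] := (@measurable_sin R, @measurable_cos R).
split.
- under eq_integral do rewrite big_cons cosD EFinB.
  rewrite integralB//; [|exact: iM|exact: iM].
  rewrite !M// Hc Hs IHc IHs mule0 sube0 -EFinM -expRD.
  by rewrite big_cons opprD.
- under eq_integral do rewrite big_cons sinD EFinD.
  rewrite integralD//; [|exact: iM|exact: iM].
  by rewrite !M// Hs IHs mule0 mul0e adde0.
Qed.

Let rectanglesS J1 J2 : {subset J1 <= J2} ->
  <<s rectangles J1 >> `<=` <<s rectangles J2 >>.
Proof.
move=> J12; apply: smallest_sub; first exact: smallest_sigma_algebra.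
apply: subset_trans (@sub_sigma_algebra _ _ _) => _ [B mB ->].
exists (fun i => if i \in J1 then B i else setT) => [i|]; first by case: ifP.
apply/seteqP; split => w wB i /= iJ; first by case: ifPn => // iJ1; exact: wB.
by have := wB i (J12 _ iJ); rewrite /= iJ.
Qed.

(** The intersection over the tail of [r] belongs to the sigma-algebra of the tail's blocks. These
    are disjoint from the block of the head, as [r] has no repetition, so each step of the induction
    splits off one factor. *)
Lemma prob_bigcap_blocks (L : finType) (blk : I -> L) (E : L -> set T)
    (rho : R) (r : seq L) :
  0 <= rho ->
  (forall l, <<s rectangles [set i | blk i == l]%SET >> (E l)) ->
  (forall l, P (E l) <= rho%:E)%E -> uniq r ->
  (P (\big[setI/setT]_(l <- r) E l) <= (rho ^+ size r)%:E)%E.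
Proof.
move=> rho0 mE PE.
have mbig s : <<s rectangles [set i | blk i \in s]%SET >> (\big[setI/setT]_(l <- s) E l).
  elim: s => [|l s IH].
    rewrite big_nil; exact: (@measurableT _ (g_sigma_algebraType (rectangles _))).
  rewrite big_cons; apply: (@measurableI _ (g_sigma_algebraType (rectangles _))).
    by apply: (rectanglesS _ (mE l)) => i; rewrite !inE => ->.
  by apply: (rectanglesS _ IH) => i; rewrite !inE => ->; rewrite orbT.
elim: r => [_|l r IH /= /andP[lr ur]].
  by rewrite big_nil expr0 probability_setT.
rewrite big_cons (mutually_independent_groups _ (mE l) (mbig r)); last first.
  by move=> i; rewrite !inE => /eqP ->.
by rewrite exprS EFinM lee_pmul// ?PE// IH.
Qed.

End mutual_independence.

(** * Recovery by the minimum estimator *)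

Lemma argmin_seqP {I : eqType} {R : realType} (f : I -> R) (r : seq I) :
  match argmin_seq f r with
  | Some t => (t \in r) && all (fun j => f t <= f j) r
  | None => r == [::]
  end.
Proof.
elim: r => //= j r; case: (argmin_seq f r) => [t|/eqP ->]; last first.
  by rewrite mem_head /= lexx.
move=> /andP[tr /allP ft]; case: (leP (f j) (f t)) => [jt|/ltW tj].
  rewrite mem_head lexx/=; apply/allP => k /ft; exact: le_trans.
by rewrite inE tr orbT tj/=; apply/allP.
Qed.

(** The selected ratio has the least modulus, so it exceeds [eps] exactly when all ratios do. For M
    = 0 the default estimate 0 never exceeds [eps], hence the explicit condition on [M]. *)
Lemma lt_norm_xhat_min {T : Type} {R : realType} {N M : nat} (x : 'I_N -> R)
    (s : 'I_N -> 'I_M -> T -> R) (i : 'I_N) (eps : R) (w : T) : 0 < eps ->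
  (eps < `|xhat_min x s i w|) =
  (0 < M)%N && [forall j, eps < `|meas x s j w / s i j w|].
Proof.
move=> eps0; rewrite /xhat_min.
have := argmin_seqP (fun j => `|meas x s j w / s i j w|) (enum 'I_M).
case: argmin_seq => [t /andP[_ /allP tmin]|/eqP/(congr1 size)]; last first.
  rewrite size_enum_ord => M0; have -> /= : (0 < M)%N = false by rewrite lt0n M0.
  by rewrite normr0 ltNge ltW.
have -> /= : (0 < M)%N by exact: leq_ltn_trans (ltn_ord t).
apply/idP/forallP => [et j|]; last exact.
by rewrite (lt_le_trans et)// tmin// mem_enum.
Qed.

Section column.
Context {d : measure_display} {T : measurableType d} {R : realType}.
Variables (P : probability T R) (N M : nat) (alpha : R).
Variables (x : 'I_N -> R) (s : 'I_N -> 'I_M -> T -> R).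
Hypothesis alpha0 : 0 < alpha.
Let X (ij : 'I_N * 'I_M) := s ij.1 ij.2.
Hypothesis indep_s : mutually_independent P X.
Hypothesis stable_s : forall i j, sym_stable_unit P alpha (s i j).
Let p := \sum_(i < N) `|x i| `^ alpha.
Let column (j : 'I_M) : {set 'I_N * 'I_M} := [set ij | ij.2 == j]%SET.

Let ms i j : measurable_fun [set: g_sigma_algebraType (rectangles X (column j))] (s i j).
Proof.
by apply: (measurable_coordinate (X := X) (i := (i, j))); rewrite inE.
Qed.

Let mmeas j : measurable_fun [set: g_sigma_algebraType (rectangles X (column j))]
  (meas x s j).
Proof.
rewrite (_ : meas x s j = fun w =>
    \sum_(ij <- [seq (i, j) | i <- index_enum 'I_N]) x ij.1 * X ij w).
  by apply: measurable_lincomb => ij /mapP[i _ ->]; rewrite inE.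
by apply/funext => w; rewrite big_map.
Qed.

(** Because x_{i0} = 0, the entry s_{i0 j} does not enter y_j. The combination is thus a linear form
    in the independent entries of column j, with coefficient b at i0 and a x_i elsewhere. *)
Lemma cf_meas_coordinate (i0 : 'I_N) (j : 'I_M) (a b : R) : x i0 = 0 ->
  (\int[P]_w (cos (a * meas x s j w + b * s i0 j w))%:E =
   (expR (- (p * `|a| `^ alpha + `|b| `^ alpha)))%:E)%E.
Proof.
move=> xi0.
pose c (ij : 'I_N * 'I_M) := a * x ij.1 + (ij.1 == i0)%:R * b.
have [|H _] := stable_lincomb indep_s c
    (r := [seq (i, j) | i <- index_enum 'I_N]) alpha0 (fun ij => stable_s ij.1 ij.2).
  by rewrite map_inj_uniq ?index_enum_uniq// => i i' [].
transitivity (\int[P]_w (cos (\sum_(k <- [seq (i, j) | i <- index_enum 'I_N])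
    c k * X k w))%:E)%E.
  apply: eq_integral => w _; congr (cos _)%:E.
  rewrite big_map /c/= /X/=; under [RHS]eq_bigr do rewrite mulrDl -mulrA.
  rewrite big_split/= -mulr_sumr; congr (_ + _).
  rewrite (bigD1 i0)//= eqxx mul1r big1 ?addr0// => i /negbTE ->.
  by rewrite !mul0r.
rewrite H; congr (expR (- _))%:E; rewrite big_map /c/=.
transitivity (\sum_(i < N) (`|x i| `^ alpha * `|a| `^ alpha +
    (i == i0)%:R * `|b| `^ alpha)).
  apply: eq_bigr => i _; have [->|ii0] := eqVneq i i0.
    by rewrite xi0 mulr0 add0r !mul1r normr0 powR0 ?gt_eqF// mul0r add0r.
  by rewrite !mul0r !addr0 normrM powRM// mulrC.
rewrite big_split/= -mulr_suml; congr (_ + _).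
rewrite (bigD1 i0)//= eqxx mul1r big1 ?addr0// => i /negbTE ->.
by rewrite mul0r.
Qed.

Variables (i0 : 'I_N) (eps : R).
Hypotheses (xi0 : x i0 = 0) (eps0 : 0 < eps) (p0 : 0 < p) (epsp : eps `^ alpha <= p).
Let W j : set T := [set w | eps < `|meas x s j w / s i0 j w|].

Let mW j : <<s rectangles X (column j) >> (W j).
Proof.
have -> : W j = (fun w => `|meas x s j w / s i0 j w|) @^-1` `]eps, +oo[%classic.
  by apply/seteqP; split => w /=; rewrite in_itv/= andbT.
apply: preimage_sub_rectangles => //.
apply: measurableT_comp => //; apply: measurable_funM => //.
exact: (measurableT_comp measurable_invr).
Qed.

Let PW j : (P (W j) <= (p / (p + eps `^ alpha))%:E)%E.
Proof.
have mY : measurable_fun setT (meas x s j).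
  exact: (measurable_fun_sub_rectangles indep_s (@mmeas j)).
have mS : measurable_fun setT (s i0 j).
  exact: (measurable_fun_sub_rectangles indep_s (@ms i0 j)).
apply: (le_trans _ (stable_ratio_prob alpha0 p0 eps0 epsp mY mS _)); last first.
  by move=> a b; exact: cf_meas_coordinate.
apply: le_measure.
- by apply: mem_set; exact: (sub_rectangles_measurable indep_s (@mW j)).
- by apply: mem_set; exact: measurable_scaled_norm_lt.
(* Division by 0 gives 0, so a vanishing entry keeps the outcome out of [W j]; only an inclusion of
   events is needed. *)
- move=> w; rewrite /W /=; have [->|s0] := eqVneq (s i0 j w) 0.
    by rewrite invr0 mulr0 normr0 ltNge (ltW eps0).
  by rewrite normrM normfV ltr_pdivlMr ?normr_gt0.
Qed.

Let VE : (0 < M)%N ->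
  [set w | eps < `|xhat_min x s i0 w|] = \big[setI/setT]_(j <- enum 'I_M) W j.
Proof.
move=> M0; rewrite -bigcap_seq; apply/seteqP; split => w /=.
  rewrite lt_norm_xhat_min// M0/= => /forallP H j _; exact: H.
move=> H; rewrite lt_norm_xhat_min// M0/=; apply/forallP => j.
by apply: H; rewrite /= mem_enum.
Qed.

Lemma xhat_min_gt_measurable : measurable [set w | eps < `|xhat_min x s i0 w|].
Proof.
have [M0|] := posnP M.
  rewrite (_ : [set w | _] = set0)//; apply/seteqP; split => w //=.
  by rewrite lt_norm_xhat_min// {1}M0.
move=> /VE ->; rewrite -bigcap_seq; apply: fin_bigcap_measurable => // j _.
exact: (sub_rectangles_measurable indep_s (@mW j)).
Qed.

Lemma xhat_min_gt_prob : (P [set w | (eps < `|xhat_min x s i0 w|)%R] <=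
  ((p / (p + eps `^ alpha)) ^+ M)%:E)%E.
Proof.
have rho0 : 0 <= p / (p + eps `^ alpha).
  by rewrite divr_ge0 ?addr_ge0 ?powR_ge0 ?(ltW p0).
(* Without measurements the bound is an empty power, that is 1. *)
have [M0|M0] := posnP M.
  rewrite {2}M0 expr0; exact: (probability_le1 P xhat_min_gt_measurable).
rewrite (VE M0) -[X in (_ ^+ X)%:E](size_enum_ord M).
by apply: (prob_bigcap_blocks indep_s (blk := snd)) => //; exact: enum_uniq.
Qed.
End column.

(** * Elementary bounds on the parameters and the expected number of false positives *)

Lemma power_sum_gt0 {R : realType} (N : nat) (x : 'I_N -> R) (alpha : R) :
  (0 < #|[set i : 'I_N | x i != 0%R]%SET|)%N ->
  0 < \sum_(i < N) `|x i| `^ alpha.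
Proof.
move=> /card_gt0P[i]; rewrite inE => xi.
rewrite (bigD1 i)//= ltr_pwDl ?powR_gt0 ?normr_gt0//.
by apply: sumr_ge0 => k _; exact: powR_ge0.
Qed.

(** Put t = eps / p^(1/alpha), so that t^alpha = eps^alpha / p. The bound on [psi] forces t <= 1,
    and then the larger exponent alpha/(1 - alpha) >= alpha gives the smaller power. The upper bound
    1 provides eps^alpha <= p, as the ratio estimate requires. *)
Lemma ratio_power_le {R : realType} (alpha eps p : R) :
    0 < alpha < 1 -> 0 < eps -> 0 < p ->
  let psi := (eps / p `^ alpha^-1) `^ (alpha / (1 - alpha)) in
  psi <= 3^-1 -> 0 < psi /\ psi <= eps `^ alpha / p <= 1.
Proof.
move=> /andP[a0 a1] eps0 p0 psi psi3.
have t0 : 0 < eps / p `^ alpha^-1 by rewrite divr_gt0// powR_gt0.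
have psi0 : 0 < psi by rewrite powR_gt0.
split => //.
have b0 : 0 < alpha / (1 - alpha) by rewrite divr_gt0// subr_gt0.
have t1 : eps / p `^ alpha^-1 <= 1.
  rewrite leNgt; apply/negP => t1.
  have : 1 <= psi.
    rewrite /psi -[leLHS](powRr0 (eps / p `^ alpha^-1)).
    by apply: ler_powR; apply: ltW.
  by move: psi3; lra.
have -> : eps `^ alpha / p = (eps / p `^ alpha^-1) `^ alpha.
  rewrite powRM ?(ltW eps0) ?invr_ge0 ?powR_ge0//; congr (_ * _).
  by rewrite -powRN -powRrM mulNr mulVf ?gt_eqF// powRN powRr1// ltW.
apply/andP; split.
  apply: ger_powR; first by rewrite t0 t1.
  by rewrite ler_pdivlMr ?subr_gt0// ler_piMr ?(ltW a0)//; lra.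
rewrite -[leRHS](powRr0 (eps / p `^ alpha^-1)).
by apply: ger_powR; [rewrite t0 t1|exact: ltW].
Qed.

(** Exponentiating the condition on [M] gives n/delta <= (1 + psi)^M, and rho^M is at most (1 +
    psi)^(-M). *)
Lemma ler_geometric_ln {R : realType} (n delta rho psi : R) (M : nat) :
  0 < n -> 0 < delta -> 0 < psi -> 0 <= rho <= (1 + psi)^-1 ->
  ln (n / delta) / ln (1 + psi) <= M%:R -> n * rho ^+ M <= delta.
Proof.
move=> n0 delta0 psi0 /andP[rho0 rhopsi].
have psi1 : 0 < 1 + psi by rewrite addr_gt0.
rewrite ler_pdivrMr ?ln_gt0 ?ltrDl// => H.
apply: (@le_trans _ _ (n * (1 + psi)^-1 ^+ M)).
  by rewrite ler_pM2l// lerXn2r ?nnegrE ?invr_ge0 ?(ltW psi1).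
rewrite exprVn ler_pdivrMr ?exprn_gt0// -ler_pdivrMl// mulrC.
rewrite -ler_ln ?posrE ?exprn_gt0 ?divr_gt0//.
by rewrite lnXn// -mulr_natl.
Qed.

Unset Implicit Arguments.

Theorem theorem2 (d : measure_display) (T : measurableType d) (R : realType)
  (P : probability T R) (N M K : nat) (alpha eps delta : R)
  (x : 'I_N -> R) (s : 'I_N -> 'I_M -> T -> R) :
  0 < alpha < 1 ->
  #|[set i : 'I_N | x i != 0]%SET| = K -> (0 < K)%N -> (K < N)%N ->
  mutually_independent P (fun ij : 'I_N * 'I_M => s ij.1 ij.2) ->
  (forall i j, sym_stable_unit P alpha (s i j)) ->
  0 < eps -> 0 < delta ->
  let theta := (\sum_(i < N) `|x i| `^ alpha) `^ (alpha^-1) in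
  let psi := (eps / theta) `^ (alpha / (1 - alpha)) in
  psi <= 3^-1 ->
  ln ((N - K)%:R / delta) / ln (1 + psi) <= M%:R ->
  (\int[P]_w ((false_positives x s eps w)%:R)%:E <= delta%:E)%E.
Proof.
move=> alpha01 xK K0 KN indep_s stable_s eps0 delta0.
have p0 : 0 < \sum_(i < N) `|x i| `^ alpha by apply: power_sum_gt0; rewrite xK.
set p := \sum_(i < N) _ in p0 * => theta psi psi3 HM.
have [psi0 /andP[psi_le q1]] := ratio_power_le alpha01 eps0 p0 psi3.
have a0 : 0 < alpha by case/andP: alpha01.
have qp : eps `^ alpha <= p by move: q1; rewrite ler_pdivrMr ?mul1r.
pose V i : set T := [set w | eps < `|xhat_min x s i w|].
have mV i : measurable (V i) := xhat_min_gt_measurable x indep_s i eps0.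
(* The count is a sum of indicators over the zero coordinates, so its mean is the sum of the
   individual probabilities. *)
under eq_integral => w _.
  rewrite (_ : (false_positives x s eps w)%:R%:E =
    \sum_(i < N | x i == 0%R) (\1_(V i) w)%:E)%E; last first.
    rewrite sumEFin; congr (_%:E).
    rewrite /false_positives -sum1_card natr_sum big_mkcond [RHS]big_mkcond/=.
    apply: eq_bigr => i _; rewrite inE; case: ifPn => [/andP[-> h]|].
      by rewrite indicE mem_set.
    by case: ifP => //= _ /negP h; rewrite indicE memNset.
  rewrite -big_filter; over.
rewrite /= ge0_integral_sum//; last first.
  by move=> i; exact/measurable_EFinP/measurable_indic.
rewrite big_filter.
pose rho := p / (p + eps `^ alpha).
apply: (@le_trans _ _ (\sum_(i < N | x i == 0%R) (rho ^+ M)%:E)%E).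
  apply: lee_sum => i /eqP xi; rewrite integral_indic// setIT.
  exact: xhat_min_gt_prob.
have cardN : #|[set i : 'I_N | x i == 0]%SET| = (N - K)%N.
  have H : (#|[set i : 'I_N | x i != 0%R]%SET| +
      #|~: [set i : 'I_N | x i != 0%R]%SET|)%N = N by rewrite cardsC card_ord.
  rewrite -[X in (X - _)%N]H xK addKn; apply: eq_card => i.
  by rewrite !inE negbK.
have -> : (\sum_(i < N | x i == 0%R) (rho ^+ M)%:E = ((N - K)%:R * rho ^+ M)%:E)%E.
  rewrite sumEFin -cardN mulr_natl -sumr_const; congr (_%:E).
  by apply: eq_bigl => i; rewrite inE.
rewrite lee_fin.
apply: (ler_geometric_ln _ _ psi0) => //; first by rewrite ltr0n subn_gt0.
(* It remains to see that p/(p + eps^alpha) <= 1/(1 + psi), which amounts to psi p <= eps^alpha,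
   that is, to [psi_le]. *)
have q0 : 0 <= eps `^ alpha by exact: powR_ge0.
rewrite divr_ge0 ?addr_ge0 ?(ltW p0)//= ler_pdivrMr ?ltr_pwDl//.
rewrite -ler_pdivrMl ?invr_gt0 ?addr_gt0// invrK.
by rewrite mulrDl mul1r lerD2l -ler_pdivlMr.
Qed.
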